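(* Let $t$ and $k$ be positive integers with $k\equiv 1 \pmod 2$, and let $G$ be a $t$-connected graph of even order $n\geq 5t+7$ that has a fractional perfect matching. If $$\rho(G)\geq \rho\big(K_t\vee(K_{n-2t-3}\cup K_3\cup tK_1)\big),$$ then $G$ has a perfect $k$-matching, unless $G\cong K_t\vee(K_{n-2t-3}\cup K_3\cup tK_1)$.
   Context: All graphs are finite, simple (no loops or multiple edges). For a graph $G$, $\rho(G)$ denotes the spectral radius of $G$, i.e. the largest eigenvalue of its adjacency matrix. $K_m$ is the complete graph on $m$ vertices; $G_1\cup G_2$ is the disjoint union, $mH$ is the disjoint union of $m$ copies of $H$, and $G_1\vee G_2$ (the join) is obtained from $G_1\cup G_2$ by adding all edges between a vertex of $G_1$ and a vertex of $G_2$. For a vertex $v$, $E_G(v)$ is the set of edges incident with $v$. A $k$-matching of $G$ is a function $f:E(G)\to\{0,1,\ldots,k\}$ with $\sum_{e\in E_G(v)} f(e)\leq k$ for every vertex $v$; it is a perfect $k$-matching if $\sum_{e\in E_G(v)} f(e)=k$ for every vertex $v$. A fractional perfect matching of $G$ is a function $f:E(G)\to[0,1]$ with $\sum_{e\in E_G(v)} f(e)=1$ for every vertex $v$. *)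

(* Defs.v *)
From mathcomp Require Import all_boot all_order all_algebra.
From mathcomp Require Import boolp classical_sets reals.

Set Implicit Arguments.
Unset Strict Implicit.
Unset Printing Implicit Defensive.

Import Order.TTheory GRing.Theory Num.Theory.

Record sgraph := SGraph {
  vertex :> finType;
  adj : rel vertex;
  adj_sym : symmetric adj;
  adj_irr : irreflexive adj
}.

Section Constructions.

Definition complete_adj m : rel 'I_m := fun x y => x != y.

Fact complete_sym m : symmetric (@complete_adj m).
Proof. by move=> x y; rewrite /complete_adj eq_sym. Qed.

Fact complete_irr m : irreflexive (@complete_adj m).
Proof. by move=> x; rewrite /complete_adj eqxx. Qed.

Definition complete m : sgraph := SGraph (@complete_sym m) (@complete_irr m).

Variables G H : sgraph.

Definition gunion_adj : rel (G + H)%type := fun x y =>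
  match x, y with
  | inl a, inl b => adj a b
  | inr a, inr b => adj a b
  | _, _ => false
  end.

Fact gunion_sym : symmetric gunion_adj.
Proof. by move=> [a|a] [b|b] //=; apply: adj_sym. Qed.

Fact gunion_irr : irreflexive gunion_adj.
Proof. by move=> [a|a] /=; apply: adj_irr. Qed.

Definition gunion : sgraph := SGraph gunion_sym gunion_irr.

Definition gjoin_adj : rel (G + H)%type := fun x y =>
  match x, y with
  | inl a, inl b => adj a b
  | inr a, inr b => adj a b
  | _, _ => true
  end.

Fact gjoin_sym : symmetric gjoin_adj.
Proof. by move=> [a|a] [b|b] //=; apply: adj_sym. Qed.

Fact gjoin_irr : irreflexive gjoin_adj.
Proof. by move=> [a|a] /=; apply: adj_irr. Qed.

Definition gjoin : sgraph := SGraph gjoin_sym gjoin_irr.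

Definition gcopies_adj m : rel ('I_m * G)%type :=
  fun x y => (x.1 == y.1) && adj x.2 y.2.

Fact gcopies_sym m : symmetric (@gcopies_adj m).
Proof. by move=> x y; rewrite /gcopies_adj eq_sym adj_sym. Qed.

Fact gcopies_irr m : irreflexive (@gcopies_adj m).
Proof. by move=> x; rewrite /gcopies_adj adj_irr andbF. Qed.

Definition gcopies m : sgraph := SGraph (@gcopies_sym m) (@gcopies_irr m).

Variable A : {set G}.

Definition induced_adj : rel {x : G | x \in A} :=
  fun x y => adj (val x) (val y).

Fact induced_sym : symmetric induced_adj.
Proof. by move=> x y; apply: adj_sym. Qed.

Fact induced_irr : irreflexive induced_adj.
Proof. by move=> x; apply: adj_irr. Qed.

Definition induced : sgraph := SGraph induced_sym induced_irr.

Definition giso : Prop :=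
  exists f : G -> H, bijective f /\ forall x y, adj (f x) (f y) = adj x y.

End Constructions.

Definition connected (G : sgraph) : Prop :=
  0 < #|G| /\ forall x y : G, connect (@adj G) x y.

Definition tconnected (t : nat) (G : sgraph) : Prop :=
  t < #|G| /\ forall S : {set G}, #|S| < t -> connected (induced (~: S)).

Definition edges (G : sgraph) : {set {set G}} :=
  [set [set p.1; p.2] | p : G * G & adj p.1 p.2].

Definition edges_at (G : sgraph) (v : G) : {set {set G}} :=
  [set e in edges G | v \in e].

(* A function on E(G) is represented by a function on all vertex sets; its
   values outside [edges G] are never used. *)
Definition kmatching (k : nat) (G : sgraph) (f : {set G} -> nat) : Prop :=
  (forall e, e \in edges G -> f e <= k) /\
  (forall v : G, \sum_(e in edges_at v) f e <= k).

Definition perfect_kmatching (k : nat) (G : sgraph) (f : {set G} -> nat) : Prop :=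
  kmatching k f /\ forall v : G, \sum_(e in edges_at v) f e = k.

Section Real.
Local Open Scope ring_scope.
Variable R : realType.

Definition fractional_perfect_matching (G : sgraph) (f : {set G} -> R) : Prop :=
  (forall e, e \in edges G -> 0 <= f e <= 1) /\
  (forall v : G, \sum_(e in edges_at v) f e = 1).

Definition adjacency_mx (G : sgraph) : 'M[R]_#|G| :=
  \matrix_(i, j) (adj (enum_val i) (enum_val j))%:R.

Definition largest_eigenvalue n (M : 'M[R]_n) (r : R) : Prop :=
  eigenvalue M r /\ forall a, eigenvalue M a -> a <= r.

(* The default 0 is only reached by the graph without vertices: a nonempty real
   symmetric matrix has a largest real eigenvalue. *)
Definition spectral_radius (G : sgraph) : R :=
  xget 0 (largest_eigenvalue (adjacency_mx G)).

End Real.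

(* K_t \/ (K_(n-2t-3) U K_3 U t K_1). *)
Definition extremal_graph (n t : nat) : sgraph :=
  gjoin (complete t)
    (gunion (gunion (complete (n - 2 * t - 3)) (complete 3))
            (gcopies (complete 1) t)).

(* Main.v *)
Require Import Defs.
From mathcomp Require Import all_boot all_order all_algebra.
From mathcomp Require Import boolp reals.
From mathcomp Require classical_sets.
From mathcomp Require Import ring lra zify.

Set Implicit Arguments.
Unset Strict Implicit.
Unset Printing Implicit Defensive.

Import Order.TTheory GRing.Theory Num.Theory.

(** A perfect matching taken k times is a perfect k-matching, so let G have no
    perfect matching.  By Lovasz's proof of Tutte's theorem, an edge-maximal
    supergraph of G without perfect matching is the join of a clique S, with
    |S| = s, and disjoint cliques, at least s + 2 of which are odd.  Here
    s >= t because G is t-connected, and at most s of the cliques are single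
    vertices because G has a fractional perfect matching.

    Let c - 1 be the spectral radius of the extremal graph.  The vector equal to
    1 on S and to s / (c - |C|) on a clique C satisfies A y <= (c - 1) y as soon
    as s + s * sum_C g(|C|) <= c, where g(x) = x / (c - x).  Convexity of g bounds
    the left side by its value phi(s) for the cliques K_(n-2s-3), K_3 and s K_1;
    phi(t) = c, and convexity of phi in s gives phi(s) < c for s > t.  Hence
    rho(G) <= c - 1, and equality forces G to be the extremal graph. *)

(** * Matchings and edge-maximal graphs *)

Section Matchings.
Variable T : finType.
Implicit Types (e : rel T) (m : T -> T) (x y z : T).

(** A matching is encoded as an involution; its fixed points are the uncovered vertices. *)
Definition matching e m := involutive m /\ forall x, m x != x -> e x (m x).
Definition exposed m := [set x | m x == x].
Definition unmatch m x := fun z => if (z == x) || (z == m x) then z else m z.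
Definition link m x y := fun z => if z == x then y else if z == y then x else m z.

Lemma exposed_unmatch m x : involutive m ->
  exposed (unmatch m x) = [set x; m x] :|: exposed m.
Proof.
by move=> mK; apply/setP=> z; rewrite !inE /unmatch; case: ifP => // _; rewrite eqxx.
Qed.

Lemma matching_unmatch e m x : matching e m -> matching e (unmatch m x).
Proof.
move=> [mK me]; split=> z; rewrite /unmatch; last first.
  by case: ifP => _; [rewrite eqxx | apply: me].
have [zx|] := boolP ((z == x) || (z == m x)); first by rewrite zx.
rewrite mK; case: (eqVneq (m z) x) => [<-|_]; first by rewrite mK eqxx orbT.
case: (eqVneq (m z) (m x)) => [/(can_inj mK) ->|_ _]; first by rewrite eqxx.
by [].
Qed.

Lemma exposed_link m x y : x != y -> x \in exposed m -> y \in exposed m ->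
  exposed (link m x y) = exposed m :\: [set x; y].
Proof.
move=> xy; rewrite !inE => xm ym; apply/setP=> z; rewrite !inE /link.
case: (eqVneq z x) => [->|zx]; first by rewrite eq_sym (negbTE xy).
by case: (eqVneq z y) => [->|zy] /=; first by rewrite (negbTE xy).
Qed.

Lemma matching_link e m x y : symmetric e -> matching e m -> x != y -> e x y ->
  x \in exposed m -> y \in exposed m -> matching e (link m x y).
Proof.
move=> es [mK me] xy exy; rewrite !inE => /eqP mx /eqP my.
split=> z; rewrite /link.
  case: (eqVneq z x) => [->|zx]; first by rewrite eq_sym (negbTE xy) eqxx.
  case: (eqVneq z y) => [->|zy]; first by rewrite eqxx.
  case: (eqVneq (m z) x) => [mz|_]; first by rewrite -(mK z) mz mx eqxx in zx.
  by case: (eqVneq (m z) y) => [mz|_ //]; rewrite -(mK z) mz my eqxx in zy.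
case: (eqVneq z x) => [->//|zx].
by case: (eqVneq z y) => [->|zy]; [rewrite es | apply: me].
Qed.

(* The alternating path of m1 and m2 that starts at d with an m1-edge ends at x;
   m' is m2 switched along it. *)
Lemma switch_alternating e m1 m2 d : symmetric e -> matching e m1 -> matching e m2 ->
  d \in exposed m2 -> d \notin exposed m1 ->
  exists m' x, matching e m' /\
   ([/\ x \in exposed m1, x \notin exposed m2 & exposed m' = x |: exposed m2 :\ d] \/
    [/\ x \in exposed m2, x != d & exposed m' = exposed m2 :\: [set d; x]]).
Proof.
move=> es Mm1; have [m1K m1e] := Mm1.
have [n] := ubnP #|[set v | m1 v != m2 v]|.
elim: n => // n IHn in m2 d *; rewrite ltnS => card_n Mm2 dm2 dm1.
have [m2K _] := Mm2.
have dx : d != m1 d by move: dm1; rewrite inE eq_sym.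
have edx : e d (m1 d) by apply: m1e; rewrite eq_sym.
set x := m1 d in dx edx *; have m1x : m1 x = d by rewrite m1K.
have [xm2|xm2] := boolP (x \in exposed m2).
  exists (link m2 d x), x; split; first exact: matching_link.
  by right; split=> //; [rewrite eq_sym | rewrite exposed_link].
set y := m2 x; have m2y : m2 y = x by rewrite m2K.
have xy : y != x by move: xm2; rewrite inE.
have m2d : m2 d = d by apply/eqP; move: dm2; rewrite inE.
have yd : y != d by apply/eqP=> yd; rewrite -m2y yd m2d eqxx in dx.
(* Two steps along the path: [d] is now matched to [x] as in [m1], and [y] is exposed instead of
   [d]. The two matchings disagree at fewer vertices, so the induction restarts from [y]. *)
set m3 := link (unmatch m2 x) d x.
have Ex3 : exposed (unmatch m2 x) = [set x; y] :|: exposed m2.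
  by rewrite exposed_unmatch.
have dE : d \in exposed (unmatch m2 x) by rewrite Ex3 inE dm2 orbT.
have xE : x \in exposed (unmatch m2 x) by rewrite Ex3 !inE eqxx.
have Mm3 : matching e m3 by apply: matching_link => //; apply: matching_unmatch.
have E3 : exposed m3 = y |: exposed m2 :\ d.
  rewrite exposed_link // Ex3; apply/setP=> z; rewrite !inE.
  have [->|zd] := eqVneq z d; first by rewrite /= orbF eq_sym (negbTE yd).
  have [->|zx] := eqVneq z x; last by [].
  by rewrite /= eq_sym (negbTE xy) /=; apply/esym/negbTE; move: xm2; rewrite inE.
have [ym1|ym1] := boolP (y \in exposed m1).
  exists m3, y; split=> //; left; split=> //.
  by rewrite inE m2y eq_sym.
have ym3 : y \in exposed m3 by rewrite E3 setU11.
case: (IHn m3 y _ Mm3 ym3 ym1).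
  apply: leq_trans card_n; apply: proper_card; apply/properP; split.
    apply/subsetP=> z; rewrite !inE /m3 /link /unmatch.
    have [->|zd] := eqVneq z d; first by rewrite eqxx.
    have [->|zx] := eqVneq z x; first by rewrite m1x eqxx.
    rewrite -/y; have [->|//] := eqVneq z y.
    rewrite /= m2y => _; apply/eqP=> m1y.
    by rewrite -(m1K y) m1y m1x eqxx in yd.
  exists d; rewrite !inE; first by rewrite m2d eq_sym.
  by rewrite /m3 /link eqxx negbK.
move=> m' [z [Mm' H]]; exists m', z; split=> //.
case: H => [] [z1 z2 Em']; [left | right]; split=> //.
- move: z2; rewrite E3 !inE negb_or negb_and negbK => /andP[zy].
  by have [zd|//] := eqVneq z d; rewrite zd (negbTE dm1) in z1.
- rewrite Em' E3; apply/setP=> v; rewrite !inE.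
  have [->|vz] //= := eqVneq v z.
  have [->|vy] //= := eqVneq v y.
  have : y \notin exposed m2 by rewrite inE m2y eq_sym.
  by rewrite inE => /negbTE ->; rewrite andbF.
- by move: z1; rewrite E3 !inE (negbTE z2) => /andP[].
- by move: z1; rewrite E3 !inE (negbTE z2) => /andP[].
- rewrite Em' E3; apply/setP=> v; rewrite !inE.
  have [->|vz] /= := eqVneq v z; first by rewrite !orbT.
  have [->|vy] //= := eqVneq v y.
    have : y \notin exposed m2 by rewrite inE m2y eq_sym.
    by rewrite inE => /negbTE ->; rewrite !andbF.
  by rewrite !orbF.
Qed.

Definition has_perfect_matching e := exists2 m, matching e m & exposed m = set0.

(** Edge-maximality without a perfect matching: the matching in the second clause becomes perfect
    once the edge xy is added. *)
Definition saturated e := ~ has_perfect_matching e /\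
  forall x y, x != y -> ~~ e x y -> exists2 m, matching e m & exposed m = [set x; y].

(** A non-edge xy at which the second clause of [saturated] fails can be added: a perfect matching
    of the larger graph either avoids xy and is perfect for [e], or exposes exactly x and y once xy
    is removed. The number of non-adjacent pairs decreases. *)
Lemma saturated_ext e : symmetric e -> irreflexive e -> ~ has_perfect_matching e ->
  exists e', [/\ symmetric e', irreflexive e', subrel e e' & saturated e'].
Proof.
have [n] := ubnP #|[set p | ~~ e p.1 p.2]|.
elim: n => // n IHn in e *; rewrite ltnS => card_n es ei ne.
have [[x [y [xy exy nm]]]|H] := pselect (exists x y, [/\ x != y, ~~ e x y &
   ~ exists2 m, matching e m & exposed m = [set x; y]]); last first.
  exists e; split=> //; split=> // x y xy exy.
  by apply: contrapT => nm; apply: H; exists x, y.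
pose e1 : rel T := fun u v => [|| e u v, (u == x) && (v == y) | (u == y) && (v == x)].
have e1s : symmetric e1.
  by move=> u v; rewrite /e1 es orbC (andbC (v == x)) (andbC (v == y)) orbC [in X in _ || X]orbC.
have e1i : irreflexive e1.
  move=> u; rewrite /e1 ei /=; have [->|] := eqVneq u x; last by rewrite andbF.
  by rewrite (negbTE xy).
have [|//|//||e' [e's e'i sub sat]] := IHn e1.
- apply: leq_trans card_n; apply: proper_card; apply/properP; split.
    by apply/subsetP=> p; rewrite !inE /e1 negb_or => /andP[].
  by exists (x, y); rewrite !inE //= /e1 !eqxx orbT.
- move=> [m Mm Em]; have [mK me] := Mm.
  have mE z : m z != z by apply/negP=> mz; have := in_set0 z; rewrite -Em inE mz.
  have [mx|mx] := eqVneq (m x) y; last first.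
    apply: ne; exists m => //; split=> // z mz.
    have := me z mz; rewrite /e1 => /or3P[//|/andP[/eqP zx /eqP mzy]|/andP[/eqP zy /eqP mzx]].
      by rewrite zx in mzy; rewrite mzy eqxx in mx.
    by rewrite -mzx mK zy eqxx in mx.
  apply: nm; exists (unmatch m x); last first.
    by rewrite exposed_unmatch // Em setU0 mx.
  have [uK ue] := matching_unmatch x Mm; split=> // z zm.
  have := ue z zm; move: zm; rewrite /unmatch mx; case: ifP => [|/norP[zx zy] _]; first by rewrite eqxx.
  by rewrite /e1 (negbTE zx) (negbTE zy) !orbF.
exists e'; split=> // u v euv; apply: sub; by rewrite /e1 euv.
Qed.

Definition universal e := [set x | [forall y, (y != x) ==> e x y]].

Lemma universalP e x : reflect (forall y, y != x -> e x y) (x \in universal e).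
Proof.
rewrite inE; apply: (iffP forallP) => H y; first by move=> yx; exact: implyP (H y) yx.
by apply/implyP; apply: H.
Qed.

(** Lovasz's argument. Otherwise take [d] not adjacent to [b], [m1] exposing [a] and [c], and [m2]
    exposing [b] and [d]. The alternating path from [d] ends at [a] or [c], and then only [b] and a
    neighbour of [b] remain exposed; or it ends at [b]. Either way a perfect matching arises. *)
Lemma saturated_transitive e a b c : symmetric e -> saturated e ->
  e a b -> e b c -> b \notin universal e -> a != b -> b != c -> a != c -> e a c.
Proof.
move=> es [ne sat] eab ebc bU ab bc ac; apply: contraT => neac.
have [d db nebd] : exists2 d, d != b & ~~ e b d.
  move: bU; rewrite inE negb_forall => /existsP[d]; rewrite negb_imply => /andP[? ?].
  by exists d.
have [m1 M1 E1] := sat _ _ ac neac.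
have bd : b != d by rewrite eq_sym.
have [m2 M2 E2] := sat _ _ bd nebd.
have dm1 : d \notin exposed m1.
  rewrite E1 !inE; apply/norP; split; apply: contraNneq nebd => ->; first by rewrite es.
  by [].
have dm2 : d \in exposed m2 by rewrite E2 !inE eqxx orbT.
have [m' [x [Mm' []]]] := switch_alternating es M1 M2 dm2 dm1; rewrite ?E1 E2.
  move=> [xac xbd Em']; case: ne; exists (link m' b x).
    apply: matching_link => //; rewrite ?Em' ?inE ?eqxx ?orbT //.
    - by move: xbd; rewrite !inE eq_sym => /norP[].
    - by move: xac; rewrite !inE => /orP[]/eqP-> //; rewrite es.
    - by rewrite bd orbT.
  rewrite exposed_link ?Em' ?inE ?eqxx ?orbT //.
  - by apply/setP=> z; rewrite !inE; case: (z == b); case: (z == x); case: (z == d).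
  - by move: xbd; rewrite !inE eq_sym => /norP[].
  - by rewrite bd orbT.
move=> [xbd xd Em']; case: ne; exists m' => //.
move: xbd; rewrite !inE (negbTE xd) orbF => /eqP xb.
by rewrite Em' xb; apply/setP=> z; rewrite !inE; case: (z == b); case: (z == d).
Qed.

Lemma card_involutive_even (A : {set T}) m : involutive m ->
  (forall x, x \in A -> m x \in A) -> (forall x, x \in A -> m x != x) -> ~~ odd #|A|.
Proof.
move=> mK mA mx; pose A1 := [set x in A | enum_rank x < enum_rank (m x)].
have -> : A = A1 :|: m @: A1.
  apply/setP=> x; rewrite !inE; apply/idP/idP.
    move=> xA; rewrite xA /=; case: ltngtP => //= [lt|eqr].
      by apply/imsetP; exists (m x); rewrite ?inE ?mK ?mA.
    by have := mx _ xA; rewrite -(inj_eq enum_rank_inj) -val_eqE /= eqr eqxx.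
  by case/orP => [/andP[]//|/imsetP[y]]; rewrite inE => /andP[yA _] ->; apply: mA.
rewrite cardsU card_imset; last exact: can_inj mK.
rewrite (_ : _ :&: _ = set0) ?cards0 ?subn0 ?addnn ?odd_double //.
apply/setP=> x; rewrite !inE; apply/negP=> /andP[/andP[_ lt]] /imsetP[y].
rewrite inE => /andP[_ lt'] xy; move: lt; rewrite xy mK.
by rewrite ltnNge ltnW.
Qed.

Lemma min_exposed_matching e : exists2 m, matching e m &
  forall m', matching e m' -> ~~ (exposed m' \proper exposed m).
Proof.
have: exists n, `[< exists2 m, matching e m & #|exposed m| = n >].
  exists #|exposed id|; apply/asboolP; exists id => //; split=> // x.
  by rewrite eqxx.
case/ex_minnP=> n /asboolP[m Mm mn] nmin; exists m => // m' Mm'.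
apply/negP=> /proper_card; rewrite mn ltnNge nmin //.
by apply/asboolP; exists m'.
Qed.

(** With the diagonal added, adjacency outside [universal e] is an equivalence by
    [saturated_transitive]; its classes are cliques with no edges between them. *)
Definition eq_or e : rel T := fun x y => (x == y) || e x y.
Definition cliques e := equivalence_partition (eq_or e) (~: universal e).

Lemma eq_or_equivalence e : symmetric e -> saturated e ->
  {in ~: universal e & &, equivalence_rel (eq_or e)}.
Proof.
move=> es sat x y z; rewrite !in_setC => xU yU zU; rewrite /eq_or eqxx.
split=> // /orP[/eqP->//|exy].
have [<-|xy] := eqVneq x y; first by [].
have [<-|xz] := eqVneq x z; first by rewrite es exy orbT.
have [<-|yz] := eqVneq y z; first by rewrite exy.
apply/idP/idP => /= [exz|eyz].
  by apply: (saturated_transitive es sat (b := x)) => //; rewrite 1?es // eq_sym.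
exact: (saturated_transitive es sat (b := y)).
Qed.

Lemma cliques_partition e : symmetric e -> saturated e ->
  partition (cliques e) (~: universal e).
Proof. by move=> es sat; apply: equivalence_partitionP; apply: eq_or_equivalence. Qed.

Lemma cliquesP e x y : symmetric e -> saturated e ->
  x \notin universal e -> y \notin universal e ->
  (y \in pblock (cliques e) x) = (x == y) || e x y.
Proof.
move=> es sat xU yU; rewrite pblock_equivalence_partition ?in_setC //.
exact: eq_or_equivalence.
Qed.

(** * Odd cliques counted through a minimal matching *)

Section MinExposed.
Variables (e : rel T) (m : T -> T).
Hypotheses (es : symmetric e) (Mm : matching e m).
Hypothesis m_min : forall m', matching e m' -> ~~ (exposed m' \proper exposed m).
Hypothesis exposed2 : 1 < #|exposed m|.

Lemma exposed_other x : exists2 w, w \in exposed m & w != x.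
Proof.
have : 0 < #|exposed m :\ x|.
  by move: exposed2; rewrite (cardsD1 x (exposed m)); case: (x \in _) => [|/ltnW].
by case/card_gt0P=> w; rewrite in_setD1 => /andP[wx wm]; exists w.
Qed.

Lemma min_exposed_stable x y :
  x \in exposed m -> y \in exposed m -> x != y -> ~~ e x y.
Proof.
move=> xm ym xy; apply/negP=> exy.
have := m_min (matching_link es Mm xy exy xm ym).
rewrite exposed_link // => /negP[]; apply/properP; split; first exact: subsetDl.
by exists x => //; rewrite !inE eqxx.
Qed.

Lemma exposed_universal x : x \in universal e -> x \notin exposed m.
Proof.
move=> /universalP xU; apply/negP=> xm; have [w wm wx] := exposed_other x.
by have := min_exposed_stable xm wm; rewrite eq_sym wx xU // => /(_ isT).
Qed.

(** A second vertex [w] exposed by [m] would stay exposed by [m'], and linking it to the universal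
    [x] would leave strictly fewer vertices exposed than [m] does. *)
Lemma exposed_shift m' x y : matching e m' -> x \in universal e ->
  y \in exposed m -> exposed m' <> x |: exposed m :\ y.
Proof.
move=> Mm' xU ym Em'; have xm := exposed_universal xU.
have [w wm wy] := exposed_other y.
have xw : x != w by apply: contraNneq xm => ->.
have xm' : x \in exposed m' by rewrite Em' setU11.
have wm' : w \in exposed m' by rewrite Em' in_setU1 in_setD1 wy wm orbT.
have exw : e x w by apply: (universalP _ _ xU); rewrite eq_sym.
have := m_min (matching_link es Mm' xw exw xm' wm').
rewrite exposed_link // => /negP[]; apply/properP; split.
  apply/subsetP=> z; rewrite Em' !inE negb_or -andbA => /and3P[zx _].
  by rewrite (negbTE zx) => /andP[].
by exists w => //; rewrite !inE eqxx orbT.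
Qed.

(** Linking [x] to a vertex [w] exposed by [m] reduces this to [exposed_shift], with [x'] gained and
    [w] lost. *)
Lemma exposed_add2 m' x x' : matching e m' -> x \in universal e -> x' \in universal e ->
  x != x' -> exposed m' <> [set x; x'] :|: exposed m.
Proof.
move=> Mm' xU x'U xx' Em'; have xm := exposed_universal xU.
have [w wm _] := exposed_other x.
have xw : x != w by apply: contraNneq xm => ->.
have xm' : x \in exposed m' by rewrite Em' !inE eqxx.
have wm' : w \in exposed m' by rewrite Em' inE wm orbT.
have exw : e x w by apply: (universalP _ _ xU); rewrite eq_sym.
apply: (exposed_shift (matching_link es Mm' xw exw xm' wm') x'U wm).
rewrite exposed_link // Em'; apply/setP=> z; rewrite !inE.
have [->|zx] := eqVneq z x.
  by rewrite /= (negbTE xx') /=; move: xm; rewrite inE => /negbTE ->; rewrite andbF.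
have [->|zw] //= := eqVneq z w.
rewrite orbF; apply/esym/negbTE; apply: contraNneq (exposed_universal x'U) => <-.
exact: wm.
Qed.

Lemma partner_universal x : x \in universal e -> m x \notin universal e.
Proof.
move=> xU; apply/negP=> mxU; have [mK _] := Mm.
apply: (exposed_add2 (matching_unmatch x Mm) xU mxU); last by rewrite exposed_unmatch.
by have := exposed_universal xU; rewrite inE eq_sym.
Qed.

(** The vertices that [m] leaves uncovered after the universal vertices are deleted. *)
Definition deficient := [set v | (v \notin universal e) &&
  ((v \in exposed m) || (m v \in universal e))].

(** If yz were an edge, both ends could be released from their partners, if any, and matched to each
    other. With none, one or two universal partners released, the result contradicts
    [min_exposed_stable], [exposed_shift] or [exposed_add2]. *)
Lemma deficient_stable y z : y \in deficient -> z \in deficient -> y != z -> ~~ e y z.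
Proof.
have key y' z' : y' \in exposed m -> z' \notin universal e -> m z' \in universal e ->
    y' != z' -> ~~ e y' z'.
  move=> ym zU mzU yz; apply/negP=> eyz; have [mK _] := Mm.
  have Eu := exposed_unmatch z' mK.
  have ym' : y' \in exposed (unmatch m z') by rewrite Eu inE ym orbT.
  have zm' : z' \in exposed (unmatch m z') by rewrite Eu !inE eqxx.
  have Mu := matching_unmatch z' Mm.
  apply: (exposed_shift (matching_link es Mu yz eyz ym' zm') mzU ym).
  have mzm := exposed_universal mzU.
  rewrite exposed_link // Eu; apply/setP=> v; rewrite !inE.
  have [->|vy] /= := eqVneq v y'.
    by rewrite orbF; apply/esym/negbTE; apply: contraNneq mzm => <-.
  have [->|//] := eqVneq v z'.
  have := mzm; rewrite inE mK => nz.
  by rewrite /= (negbTE nz) /= eq_sym (negbTE nz).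
rewrite inE => /andP[yU yD]; rewrite inE => /andP[zU zD] yz.
case/orP: yD => [ym|myU]; case/orP: zD => [zm|mzU].
- exact: min_exposed_stable.
- exact: key.
- by rewrite es; apply: key; rewrite 1?eq_sym.
apply/negP=> eyz; have [mK _] := Mm.
set m1 := unmatch m y; have M1 : matching e m1 := matching_unmatch y Mm.
have E1 : exposed m1 = [set y; m y] :|: exposed m by rewrite exposed_unmatch.
have m1z : m1 z = m z.
  rewrite /m1 /unmatch ifN // negb_or eq_sym yz.
  by apply: contraNneq zU => ->.
set m2 := unmatch m1 z; have M2 : matching e m2 := matching_unmatch z M1.
have E2 : exposed m2 = [set z; m z] :|: ([set y; m y] :|: exposed m).
  by rewrite exposed_unmatch ?m1z ?E1 //; case: M1.
have ym2 : y \in exposed m2 by rewrite E2 !inE eqxx !orbT.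
have zm2 : z \in exposed m2 by rewrite E2 !inE eqxx.
have myz : m y != m z by rewrite (can_eq mK).
apply: (exposed_add2 (matching_link es M2 yz eyz ym2 zm2) myU mzU myz).
rewrite exposed_link // E2; apply/setP=> v; rewrite !inE.
have yE : (m y == y) = false by apply: contraNF yU => /eqP <-.
have zE : (m z == z) = false by apply: contraNF zU => /eqP <-.
have [->|vy] /= := eqVneq v y.
  rewrite eq_sym yE /= orbF; apply/esym/negbTE; apply: contraNneq yU => ->.
  by [].
have [->|vz] /= := eqVneq v z.
  rewrite (eq_sym z (m z)) zE !orbF; apply/esym/negbTE; apply: contraNneq zU => ->.
  by [].
by rewrite orbCA orbA.
Qed.

(** At least two vertices are exposed, and the universal vertices have distinct partners, none of
    them universal by [partner_universal]. *)
Lemma leq_card_deficient : #|universal e| + 2 <= #|deficient|.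
Proof.
have [mK me] := Mm.
have sub : exposed m :|: m @: universal e \subset deficient.
  apply/subsetP=> v; rewrite inE => /orP[vm|/imsetP[x xU ->]]; rewrite inE.
    by rewrite vm andbT; apply: contraL vm => /exposed_universal.
  by rewrite mK xU (partner_universal xU) orbT.
apply: leq_trans (subset_leq_card sub); rewrite cardsU card_imset; last exact: can_inj mK.
rewrite (_ : _ :&: _ = set0) ?cards0 ?subn0 ?[_ + 2]addnC ?leq_add2r //.
apply/setP=> v; rewrite in_setI in_set0; apply/negP=> /andP[vm /imsetP[x xU vx]].
have := exposed_universal xU; move: vm; rewrite vx !inE mK eq_sym => /eqP->.
by rewrite eqxx.
Qed.

Hypothesis sat : saturated e.

(** Deficient vertices are never adjacent, so [v] is the only one in its clique, and [m] pairs the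
    other vertices within the clique. *)
Lemma odd_deficient_clique v : v \in deficient -> odd #|pblock (cliques e) v|.
Proof.
move=> vD; have [mK me] := Mm.
have vU : v \notin universal e by move: vD; rewrite inE => /andP[].
have /and3P[/eqP covP _ _] := cliques_partition es sat.
have vC : v \in pblock (cliques e) v by rewrite mem_pblock covP in_setC.
have CU z : z \in pblock (cliques e) v -> z \notin universal e.
  move=> zC; rewrite -in_setC -covP; apply/bigcupP.
  by exists (pblock (cliques e) v) => //; apply: pblock_mem; rewrite covP in_setC.
rewrite (cardsD1 v) vC oddD /=; apply: (card_involutive_even mK) => z.
  rewrite !in_setD1 => /andP[zv zC]; have zU := CU _ zC.
  have vz : eq_or e v z by rewrite /eq_or -cliquesP.
  have evz : e v z by move: vz; rewrite /eq_or eq_sym (negbTE zv).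
  have zD : z \notin deficient.
    by apply: contraL evz => zD; apply: deficient_stable => //; rewrite eq_sym.
  move: zD; rewrite inE zU /= negb_or inE => /andP[mz mzU].
  apply/andP; split.
    apply: contraTneq vD => <-; rewrite inE mzU /= negb_or mK zU andbT.
    by rewrite inE mK eq_sym.
  have /and3P[_ tP _] := cliques_partition es sat.
  by rewrite -(same_pblock tP zC) cliquesP // me // orbT.
rewrite in_setD1 => /andP[zv zC]; have zU := CU _ zC.
have evz : e v z by move: zC; rewrite cliquesP // eq_sym (negbTE zv).
have zD : z \notin deficient.
  by apply: contraL evz => zD; apply: deficient_stable => //; rewrite eq_sym.
by move: zD; rewrite inE zU /= negb_or inE => /andP[].
Qed.

Lemma leq_card_odd_cliques_min :
  #|universal e| + 2 <= #|[set C in cliques e | odd #|C|]|.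
Proof.
apply: leq_trans leq_card_deficient _.
have /and3P[/eqP covP tP _] := cliques_partition es sat.
have DU v : v \in deficient -> v \notin universal e by rewrite inE => /andP[].
rewrite -(card_in_imset (f := pblock (cliques e))); last first.
  move=> y z yD zD eqC; apply/eqP; apply: contraT => yz.
  have : z \in pblock (cliques e) y by rewrite eqC mem_pblock covP in_setC DU.
  by rewrite cliquesP ?DU // (negbTE yz) (negbTE (deficient_stable yD zD yz)).
apply: subset_leq_card; apply/subsetP=> C /imsetP[v vD ->].
by rewrite inE odd_deficient_clique // andbT pblock_mem // covP in_setC DU.
Qed.

End MinExposed.

(** The exposed set of a minimal matching is non-empty because no matching is perfect, and even
    because the order is; so it has at least two vertices. *)
Lemma leq_card_odd_cliques e : symmetric e -> saturated e -> ~~ odd #|T| ->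
  #|universal e| + 2 <= #|[set C in cliques e | odd #|C|]|.
Proof.
move=> es sat evT; have [m Mm m_min] := min_exposed_matching e.
apply: (leq_card_odd_cliques_min es Mm m_min) => //; have [mK me] := Mm.
have : #|exposed m| != 0.
  by rewrite cards_eq0; apply/eqP=> Em; case: sat => -[]; exists m.
have : ~~ odd #|exposed m|.
  move: evT; rewrite -(cardsC (exposed m)) oddD.
  rewrite (negbTE (@card_involutive_even (~: exposed m) m mK _ _)) ?addbF // => x; rewrite !inE //.
  by rewrite mK eq_sym.
by case: #|exposed m| => [|[|]].
Qed.

End Matchings.

(** * Sums over clique sizes *)

Section CliqueSizes.
Variables (I : finType) (P : {set I}) (x : I -> nat) (s : nat).
Hypothesis x_gt0 : forall i, i \in P -> 0 < x i.
Let big_odd := [set i in P | odd (x i) & x i != 1].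
Let single := [set i in P | x i == 1].
Hypothesis many_odd : s + 2 <= #|[set i in P | odd (x i)]|.
Hypothesis few_single : #|single| <= s.

Lemma card_odd_split : #|[set i in P | odd (x i)]| = #|single| + #|big_odd|.
Proof.
rewrite -cardsUI (_ : _ :&: _ = set0) ?cards0 ?addn0; last first.
  by apply/setP=> i; rewrite !inE; case: (x i == 1); rewrite ?andbF.
congr #|pred_of_set _|; apply/setP=> i; rewrite !inE.
by have [->|] := eqVneq (x i) 1; rewrite ?andbT ?andbF ?orbF.
Qed.

Lemma big_odd_ge3 i : i \in big_odd -> 3 <= x i.
Proof. by rewrite !inE => /and3P[_]; case: (x i) => [|[|[|]]]. Qed.

Lemma leq_card_sum (A : {set I}) : A \subset P -> #|A| <= \sum_(i in A) x i.
Proof.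
move=> AP; rewrite -sum1_card; apply: leq_sum => i iA; apply: x_gt0.
exact: subsetP iA.
Qed.

(** At least two odd cliques have size 3 or more, so one of them differs from [i] and contributes 3;
    at least s further cliques contribute 1 each. *)
Lemma clique_size_le i : i \in P -> x i + s + 3 <= \sum_(j in P) x j.
Proof.
move=> iP; have c2 : 1 < #|big_odd|.
  by have := card_odd_split; lia.
have [j jB ji] : exists2 j, j \in big_odd & j != i.
  have : 0 < #|big_odd :\ i| by move: c2; rewrite (cardsD1 i big_odd); lia.
  by case/card_gt0P=> j; rewrite in_setD1 => /andP[? ?]; exists j.
have jP : j \in P by move: jB; rewrite inE => /andP[].
rewrite (big_setD1 i) //= (big_setD1 j) ?in_setD1 ?ji //=.
have /leq_card_sum : P :\ i :\ j \subset P by rewrite setDDl subsetDl.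
have : #|P| <= #|P :\ i :\ j| + 2.
  by rewrite (cardsD1 i P) iP (cardsD1 j (P :\ i)) in_setD1 ji jP; lia.
have : s + 2 <= #|P|.
  by apply: leq_trans many_odd (subset_leq_card _); apply/subsetP=> k; rewrite inE => /andP[].
have := big_odd_ge3 jB; lia.
Qed.

Lemma exists_big_odd : exists2 i, i \in P & 3 <= x i.
Proof.
have : 0 < #|big_odd| by have := card_odd_split; lia.
case/card_gt0P=> i iB; exists i; last exact: big_odd_ge3.
by move: iB; rewrite inE => /andP[].
Qed.

(** The s singletons leave N + 3 for the two larger cliques; as one of these has size 3 or N, the
    other has the complementary size. *)
Lemma two_big_odd N : \sum_(j in P) x j = N + s + 3 -> s = #|single| -> #|big_odd| = 2 ->
  (forall i, i \in P -> odd (x i) /\ [\/ x i = 1, x i = 3 | x i = N]) ->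
  exists a b, [/\ a \in P, b \in P, x a = N & x b = 3] /\
    forall i, i \in P -> i != a -> i != b -> x i = 1.
Proof.
move=> sumE ss bo2 d0.
have /cards2P[a [b [ab bE]]] : #|big_odd| == 2 by apply/eqP.
have aB : a \in big_odd by rewrite bE !inE eqxx.
have bB : b \in big_odd by rewrite bE !inE eqxx orbT.
have aP : a \in P by move: aB; rewrite inE => /andP[].
have bP : b \in P by move: bB; rewrite inE => /andP[].
have rest i : i \in P -> i != a -> i != b -> x i = 1.
  move=> iP ia ib; have : i \notin big_odd by rewrite bE !inE negb_or ia ib.
  by rewrite inE iP (d0 _ iP).1 /= negbK => /eqP.
have sumab : (x a + x b = N + 3).
  have := sumE; rewrite (big_setD1 a) //= (big_setD1 b) ?in_setD1 1?eq_sym ?ab //=.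
  rewrite (eq_bigr (fun=> 1)); last first.
    by move=> i; rewrite !in_setD1 => /and3P[ib ia iP]; apply: rest.
  rewrite sum1_card (_ : P :\ a :\ b = single); first by lia.
  apply/setP=> i; rewrite !in_setD1 inE.
  have [->|ib] /= := eqVneq i b.
    by move: bB; rewrite inE => /and3P[_ _ /negbTE->]; rewrite andbF.
  have [->|ia] /= := eqVneq i a.
    by move: aB; rewrite inE => /and3P[_ _ /negbTE->]; rewrite andbF.
  by case: (boolP (i \in P)) => //= iP; rewrite (rest _ iP ia ib).
have a3 := big_odd_ge3 aB; have b3 := big_odd_ge3 bB.
have [_ ha] := d0 _ aP.
have [xa|xa] := eqVneq (x a) N.
  by exists a, b; split=> //; split=> //; lia.
have xa3 : x a = 3 by case: ha => // h; [lia | rewrite h eqxx in xa].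
exists b, a; split=> [|i iP ib ia]; last exact: rest.
by split=> //; lia.
Qed.

Section Sum.
Local Open Scope ring_scope.
Variables (R : realFieldType) (c : R) (N : nat).
Hypothesis sumE : (\sum_(j in P) x j = N + s + 3)%N.
Hypotheses (c3 : 3 < c) (cN : N%:R < c).
Let g (k : nat) : R := k%:R / (c - k%:R).
(* kappa is the slope of the chord of g between 3 and N. *)
Let kappa : R := c / ((c - 3) * (c - N%:R)).
(** The chord is kappa x - alpha, and kappa x - beta agrees with g at x = 1. Thus [defect] measures
    how far g lies below an affine bound of slope kappa: through g(1) for singletons, the chord for
    larger odd cliques, kappa x for even ones. *)
Let alpha := 3 * kappa - g 3.
Let beta := kappa - g 1.

Let defect i := kappa * (x i)%:R - g (x i)
  - (if x i == 1%N then beta else if odd (x i) then alpha else 0).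

Lemma x_le_N i : i \in P -> (x i <= N)%N.
Proof. by move/clique_size_le; rewrite sumE; lia. Qed.

Lemma N_ge3 : (3 <= N)%N.
Proof. by have [i /x_le_N] := exists_big_odd; lia. Qed.

(** For odd sizes from 3 to N, chord minus g has the factor (x - 3)(N - x) and a positive cofactor;
    for even sizes the bound kappa x is strict. *)
Lemma defect_ge0 i : i \in P -> 0 <= defect i /\
  (defect i = 0 -> odd (x i) /\ [\/ x i = 1%N, x i = 3%N | x i = N]).
Proof.
have c3' := c3; have cN' := cN; move=> iP; rewrite /defect; have xN := x_le_N iP; have x0 := x_gt0 iP.
have xc : (x i)%:R < c by apply: le_lt_trans cN; rewrite ler_nat.
have [x1|x1] := eqVneq (x i) 1%N.
  by rewrite x1 /beta mulr1 subrr; split=> // _; split=> //; constructor 1.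
have xR : 0 < (x i)%:R :> R by rewrite ltr0n.
have xNR : (x i)%:R <= N%:R :> R by rewrite ler_nat.
have d3 : 0 < (c - 3)^-1 by rewrite invr_gt0 subr_gt0.
have dN : 0 < (c - N%:R)^-1 by rewrite invr_gt0 subr_gt0.
have dx : 0 < (c - (x i)%:R)^-1 by rewrite invr_gt0 subr_gt0.
have [ox|ox] := ifPn.
  have x3 : (3 <= x i)%N by apply: big_odd_ge3; rewrite inE iP ox.
  have x3R : 3 <= (x i)%:R :> R by rewrite (ler_nat R 3).
  have -> : kappa * (x i)%:R - g (x i) - alpha = ((x i)%:R - 3) * (N%:R - (x i)%:R) *
      (c * (c - 3)^-1 * (c - N%:R)^-1 * (c - (x i)%:R)^-1).
    by rewrite /alpha /kappa /g; field; rewrite !gt_eqF //; lra.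
  have K : 0 < c * (c - 3)^-1 * (c - N%:R)^-1 * (c - (x i)%:R)^-1.
    by do 3!(apply: mulr_gt0 => //); lra.
  split; first by apply: mulr_ge0; [apply: mulr_ge0; lra | exact: ltW].
  move/eqP; rewrite mulf_eq0 (gt_eqF K) orbF mulf_eq0 !subr_eq0 => eq0; split=> //; case/orP: eq0 => /eqP h.
    by constructor 2; apply/eqP; rewrite -(eqr_nat R) h.
  by constructor 3; apply/eqP; rewrite -(eqr_nat R) h.
rewrite subr0.
have h : 0 < kappa * (x i)%:R - g (x i).
  have -> : kappa * (x i)%:R - g (x i) = (x i)%:R * (c - 3)^-1 * (c - N%:R)^-1 *
     (c - (x i)%:R)^-1 * (c * (N%:R - (x i)%:R) + 3 * (c - N%:R)).
    by rewrite /kappa /g; field; rewrite !gt_eqF //; lra.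
  apply: mulr_gt0; first by do 3!(apply: mulr_gt0 => //).
  apply: ltr_wpDl; last by lra.
  by apply: mulr_ge0; lra.
by split; [exact: ltW | move=> h0; rewrite h0 ltxx in h].
Qed.

(** Linear programming duality as an identity: kappa, alpha and alpha - beta are the multipliers of
    the total size, of [many_odd] and of [few_single], so the right side is a sum of slacks. *)
Lemma clique_sum_defect :
  s%:R * g 1 + g 3 + g N - \sum_(i in P) g (x i) =
  \sum_(i in P) defect i + (alpha - beta) * (s%:R - #|single|%:R)
   + alpha * (#|single| + #|big_odd|)%:R - alpha * (s%:R + 2).
Proof.
have c3' := c3; have cN' := cN.
have -> : \sum_(i in P) defect i = kappa * (N + s + 3)%:R - \sum_(i in P) g (x i)
    - (beta * #|single|%:R + alpha * #|big_odd|%:R).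
  rewrite /defect !sumrB -mulr_sumr -natr_sum sumE; congr (_ - _).
  rewrite (bigID (fun i => x i == 1%N)) /=; congr (_ + _).
    rewrite (eq_bigr (fun=> beta)) => [|i /andP[_ ->]//].
    rewrite sumr_const mulr_natr; congr (_ *+ _).
    by apply: eq_card => i; rewrite !inE.
  rewrite (bigID (fun i => odd (x i))) /= [X in _ + X]big1 ?addr0; last first.
    by move=> i /andP[/andP[_ /negbTE->] /negbTE->].
  rewrite (eq_bigr (fun=> alpha)); last first.
    by move=> i /andP[/andP[_ /negbTE->] ->].
  rewrite sumr_const mulr_natr; congr (_ *+ _).
  by apply: eq_card => i; rewrite inE unfold_in; case: (i \in P); case: (odd _); case: (_ == _).
have gN : g N = g 3 + kappa * (N%:R - 3).
  by rewrite /g /kappa; field; rewrite !gt_eqF //; lra.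
by rewrite gN !natrD /alpha /beta; ring.
Qed.

Lemma alpha_gt0 : 0 < alpha.
Proof.
have c3' := c3; have cN' := cN.
have -> : alpha = 3 * N%:R / ((c - 3) * (c - N%:R)).
  by rewrite /alpha /kappa /g; field; rewrite !gt_eqF //; lra.
have N0 : 0 < N%:R :> R by rewrite ltr0n; have := N_ge3; lia.
by apply: divr_gt0; [lra | apply: mulr_gt0; lra].
Qed.

Lemma alpha_gt_beta : 0 < alpha - beta.
Proof.
have c3' := c3; have cN' := cN.
have N3 : 3 <= N%:R :> R by rewrite (ler_nat R 3) N_ge3.
have -> : alpha - beta = 2 * c * (N%:R - 1) / ((c - 3) * (c - N%:R) * (c - 1)).
  by rewrite /alpha /beta /kappa /g; field; rewrite !gt_eqF //; lra.
apply: divr_gt0; first by apply: mulr_gt0; lra.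
by apply: mulr_gt0; [apply: mulr_gt0|]; lra.
Qed.

Lemma clique_sum_le : \sum_(i in P) g (x i) <= s%:R * g 1 + g 3 + g N /\
  (\sum_(i in P) g (x i) = s%:R * g 1 + g 3 + g N ->
   exists a b, [/\ a \in P, b \in P, x a = N & x b = 3%N] /\
     forall i, i \in P -> i != a -> i != b -> x i = 1%N).
Proof.
have D0 : 0 <= \sum_(i in P) defect i.
  by apply: sumr_ge0 => i /defect_ge0[].
have A0 := alpha_gt0; have AB0 := alpha_gt_beta.
have S0 : 0 <= s%:R - #|single|%:R :> R by rewrite subr_ge0 ler_nat.
have B0 : 0 <= (#|single| + #|big_odd|)%:R - (s%:R + 2) :> R.
  by rewrite subr_ge0 -(natrD R s 2) ler_nat -card_odd_split.
have := clique_sum_defect; rewrite -[_ - alpha * _]addrA -mulrBr => E.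
have AS0 : 0 <= (alpha - beta) * (s%:R - #|single|%:R) by apply: mulr_ge0 => //; exact: ltW.
have AO0 : 0 <= alpha * ((#|single| + #|big_odd|)%:R - (s%:R + 2)).
  by apply: mulr_ge0 => //; exact: ltW.
split; first by rewrite -subr_ge0 E; lra.
(* Equality makes every slack vanish: exactly s + 2 odd cliques, exactly s singletons, and only the
   sizes 1, 3 and N. *)
move=> eqS; rewrite eqS subrr in E.
have /eqP : alpha * ((#|single| + #|big_odd|)%:R - (s%:R + 2)) = 0 by lra.
rewrite mulf_eq0 gt_eqF //= subr_eq0 -(natrD R s 2) eqr_nat => /eqP so.
have /eqP : (alpha - beta) * (s%:R - #|single|%:R) = 0 by lra.
rewrite mulf_eq0 gt_eqF //= subr_eq0 eqr_nat => /eqP ss.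
have {}D0 : \sum_(i in P) defect i = 0 by lra.
have d0 i : i \in P -> odd (x i) /\ [\/ x i = 1%N, x i = 3%N | x i = N].
  move=> iP; have [_] := defect_ge0 iP; apply.
  by apply: (psumr_eq0P _ D0) => // j /defect_ge0[].
have bo2 : #|big_odd| = 2%N.
  by apply/eqP; rewrite -(eqn_add2l #|single|) so ss.
exact: (two_big_odd sumE ss bo2 d0).
Qed.

End Sum.
End CliqueSizes.

(** * The function phi *)

Section Numerics.
Local Open Scope ring_scope.
Variable R : rcfType.
Implicit Types (t n s c : R).

(* For the graph K_s \/ (K_(n-2s-3) U K_3 U s K_1), a number r > n - 2s - 4, r > 2
   is the spectral radius iff [phi n s (r + 1) = r + 1]. *)
Definition phi n s c := s ^+ 2 / (c - 1) + 3 * s / (c - 3) + s * c / (c - n + 3 + 2 * s).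

(** This is c - phi n t c multiplied by its three denominators, which makes the intermediate value
    theorem for polynomials applicable. *)
Definition phi_poly n t : {poly R} :=
  'X * ('X - 1%:P) * ('X - 3%:P) * ('X - (n - 3 - 2 * t)%:P)
  - (t ^+ 2)%:P * ('X - 3%:P) * ('X - (n - 3 - 2 * t)%:P)
  - (3 * t)%:P * ('X - 1%:P) * ('X - (n - 3 - 2 * t)%:P)
  - t%:P * 'X * ('X - 1%:P) * ('X - 3%:P).

(* The shape makes the sign visible for c near n - t - 3, where u = 0. *)
Lemma horner_phi_poly n t c : (phi_poly n t).[c] =
  let u := c - (n - t - 3) in
  u * (c * (c - 1) * (c - 3)) - (t + u) * (t ^+ 2 * (c - 3) + 3 * t * (c - 1)).
Proof. by rewrite /phi_poly !(hornerD, hornerN, hornerM, hornerC, hornerX) /=; ring. Qed.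

(* 81/100 lies between 0.8091, the ratio c / n at which the graph with the
   largest possible s, (n - 6) / 2, would catch up (it has radius about
   (1 + sqrt 5) / 2 * s), and 0.8126, the ratio c / n when n is about 5 t. *)
Lemma phi_root n t : 1 <= t -> 5 * t + 7 <= n ->
  exists c, [/\ n - t - 3 < c, c < n - 3, 81 / 100 * n - 186 / 100 <= c & phi n t c = c].
Proof.
move=> t1 tn; set c0 := 81 / 100 * n - 186 / 100; set c1 := n - t - 3.
have hi : 0 < (phi_poly n t).[n - 3].
  rewrite horner_phi_poly /=; have [c cE] : exists c, c = n - 3 by exists (n - 3).
  rewrite -cE; have -> : c - (n - t - 3) = t by rewrite cE; ring.
  have c5 : 5 * t + 4 <= c by rewrite cE; lra.
  have -> : t * (c * (c - 1) * (c - 3)) - (t + t) * (t ^+ 2 * (c - 3) + 3 * t * (c - 1))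
   = t * (((c * (c - 1) - 2 * t ^+ 2 - 6 * t) * (c - 3)) - 12 * t) by ring.
  rewrite pmulr_rgt0; last lra.
  have h1 : 23 * t ^+ 2 + 12 <= c * (c - 1) - 2 * t ^+ 2 - 6 * t by nra.
  have h2 : 5 * t + 1 <= c - 3 by lra.
  have h3 : (23 * t ^+ 2 + 12) * (5 * t + 1) <= (c * (c - 1) - 2 * t ^+ 2 - 6 * t) * (c - 3).
    by apply: ler_pM => //; nra.
  nra.
have c01 : c0 <= n - 3 by rewrite /c0; lra.
(* It remains to find a point [b], beyond both lower bounds, where the polynomial is not
   positive. *)
have low b : c1 <= b -> c0 <= b -> b <= n - 3 -> (phi_poly n t).[b] <= 0 ->
    exists c, [/\ c1 < c, c < n - 3, c0 <= c & phi n t c = c].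
  move=> c1b c0b bn Qb; have [|c] := @poly_ivt _ (phi_poly n t) b (n - 3) bn.
    by rewrite Qb ltW.
  move=> /andP[bc cn] /rootP Qc.
  have cn' : c < n - 3.
    by rewrite lt_neqAle cn andbT; apply/eqP=> cE; rewrite cE in Qc; rewrite Qc ltxx in hi.
  have c1c : c1 < c.
    rewrite lt_neqAle (le_trans c1b bc) andbT; apply/eqP=> cE.
    have := horner_phi_poly n t c; rewrite Qc -/c1 -cE subrr /= => /esym.
    have : 0 < (t + 0) * (t ^+ 2 * (c1 - 3) + 3 * t * (c1 - 1)).
      by rewrite /c1 addr0; apply: mulr_gt0; nra.
    nra.
  exists c; split=> //; first exact: le_trans bc.
  have := horner_phi_poly n t c; rewrite Qc /= => Q0.
  rewrite /c1 in c1c; rewrite /phi.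
  have d1 : c - 1 != 0 by rewrite gt_eqF //; lra.
  have d3 : c - 3 != 0 by rewrite gt_eqF //; lra.
  have dn : c - n + 3 + 2 * t != 0 by rewrite gt_eqF //; lra.
  apply/eqP; rewrite -subr_eq0; apply/eqP.
  (* The numerator 0 is the value of [phi_poly] at c; [Q0] expands it, and [field] then checks the
     identity. *)
  have -> : t ^+ 2 / (c - 1) + 3 * t / (c - 3) + t * c / (c - n + 3 + 2 * t) - c =
    - (0 : R) / ((c - 1) * (c - 3) * (c - n + 3 + 2 * t)); last by rewrite oppr0 mul0r.
  rewrite {}Q0; field; by rewrite d1 d3 dn.
have [c10|c10] := leP c0 c1.
  apply: (low c1) => //; first by rewrite /c1; lra.
  rewrite horner_phi_poly /= -/c1 subrr mul0r sub0r oppr_le0 /c1.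
  by apply: mulr_ge0; nra.
apply: (low c0) => //; first exact: ltW.
have [u uE] : exists u, u = c0 - c1 by exists (c0 - c1).
have u0 : 0 < u by rewrite uE subr_gt0.
(* The bound w >= 19 / 100 below is 5 t + 7 <= n rewritten, u > 0 gives w <= t / 20, and [c0]
   becomes affine in t and w. *)
have [w wE] : exists w, w = 5 / 100 * t - u by exists (5 / 100 * t - u).
have w0 : 19 / 100 <= w by rewrite wE uE /c0 /c1; lra.
have wt : w <= 5 / 100 * t by rewrite wE; lra.
have c0w : c0 = 405 / 100 * t + 3 + 81 / 19 * w by rewrite wE uE /c0 /c1; field.
(* The constant 3 of [c0w] is absorbed through w >= 19 / 100. *)
have cle : c0 <= 405 / 100 * t + 20 * w + 1 / 10 * w by rewrite c0w; lra.
rewrite horner_phi_poly /= -/c1 -uE.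
(* This bounds the positive term of [horner_phi_poly] by t^3 (c0 - 3), which the negative term
   outweighs. *)
have cub : c0 * (c0 - 1) * u <= t ^+ 3.
  have c04 : 4 <= c0 by rewrite c0w; lra.
  have h1 : c0 * (c0 - 1) <= (405 / 100 * t + 20 * w + 1 / 10 * w) ^+ 2.
    by rewrite expr2; apply: ler_pM; lra.
  have h2 : (405 / 100 * t + 20 * w + 1 / 10 * w) ^+ 2 <= t * (17 * t + 184 * w) by nra.
  have h3 : c0 * (c0 - 1) * u <= t * (17 * t + 184 * w) * u.
    by apply: ler_wpM2r; lra.
  apply: (le_trans h3); have -> : u = 5 / 100 * t - w by lra.
  have h4 : (17 * t + 184 * w) * (5 / 100 * t - w) <= t ^+ 2 by nra.
  by rewrite exprS -mulrA; apply: ler_wpM2l => //; lra.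
have : c0 * (c0 - 1) * u * (c0 - 3) <= t ^+ 3 * (c0 - 3).
  by apply: ler_wpM2r => //; rewrite c0w; lra.
have : 0 <= (t + u) * (3 * t * (c0 - 1)).
  by apply: mulr_ge0; [lra | apply: mulr_ge0; rewrite ?c0w; lra].
have : 0 <= u * (t ^+ 2 * (c0 - 3)).
  by apply: mulr_ge0; [lra | apply: mulr_ge0; rewrite ?c0w; nra].
set A := c0; clearbody A; clear; nra.
Qed.

(** At this end K_(n-2s-3) has shrunk to a second K_3. The lower bounds 16/10 s + 32/10 and 162/100
    s + 3 for c cross at s = 10, where the cases split; the slope 162/100 exceeds the golden ratio,
    as large s requires. *)
Lemma phi_endpoint n t c : 1 <= t -> 5 * t + 7 <= n -> n - t - 3 < c ->
  81 / 100 * n - 186 / 100 <= c -> phi n ((n - 6) / 2) c < c.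
Proof.
move=> t1 tn c1 c0; set s := (n - 6) / 2.
have nE : n = 2 * s + 6 by rewrite /s; field.
have s3 : 3 <= s by rewrite /s; lra.
have cA : 16 / 10 * s + 32 / 10 < c by rewrite /s; lra.
have cB : 162 / 100 * s + 3 <= c by rewrite /s; lra.
have d1 : 0 < c - 1 by lra.
have d3 : 0 < c - 3 by lra.
have mono (a b x : R) : 0 < a -> a <= b -> 0 <= x -> x / b <= x / a.
  move=> a0 ab x0; rewrite ler_wpM2l // lef_pV2 ?posrE //.
  exact: lt_le_trans ab.
have -> : phi n s c = s ^+ 2 / (c - 1) + 6 * s / (c - 3) + s.
  rewrite /phi nE; have -> : c - (2 * s + 6) + 3 + 2 * s = c - 3 by ring.
  by field; rewrite !gt_eqF.
have [s10|s10] := leP s 10.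
  apply: le_lt_trans cA.
  have h1 : s ^+ 2 / (c - 1) <= s ^+ 2 / (16 / 10 * s + 22 / 10).
    by apply: mono; [lra | lra | nra].
  have h2 : 6 * s / (c - 3) <= 6 * s / (16 / 10 * s + 2 / 10) by apply: mono; lra.
  suff : s ^+ 2 / (16 / 10 * s + 22 / 10) + 6 * s / (16 / 10 * s + 2 / 10) <=
    6 / 10 * s + 32 / 10 by lra.
  rewrite addf_div ?gt_eqF //; [|lra|lra].
  rewrite ler_pdivrMr; last by apply: mulr_gt0; lra.
  have : 0 <= s * ((s - 3) * (10 - s)) by apply: mulr_ge0; [lra | apply: mulr_ge0; lra].
  have : 0 <= (s - 3) * (10 - s) by apply: mulr_ge0; lra.
  nra.
have h1 : s ^+ 2 / (c - 1) <= s ^+ 2 / (162 / 100 * s + 2).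
  by apply: mono; [lra | lra | nra].
have h2 : 6 * s / (c - 3) <= 6 * s / (162 / 100 * s) by apply: mono; lra.
have h3 : 6 * s / (162 / 100 * s) = 100 / 27 by field; lra.
have h4 : s ^+ 2 / (162 / 100 * s + 2) < 62 / 100 * s - 19 / 27.
  by rewrite ltr_pdivrMr; nra.
lra.
Qed.

(* phi is convex in s on [t, (n - 6) / 2], equals c at the left end and is less
   than c at the right end. *)
Lemma phi_lt n t s c : n - t - 3 < c -> c < n - 3 -> 3 < c -> 0 < t ->
  phi n t c = c -> phi n ((n - 6) / 2) c < c -> t < s -> 2 * s + 6 <= n ->
  phi n s c < c.
Proof.
move=> c1 c2 c3 t0; have [z zE] : exists z, z = (n - 6) / 2 by exists ((n - 6) / 2).
rewrite -zE => ft fz ts sz; have {}sz : s <= z by rewrite zE; lra.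
have [D DE] : exists D, D = c - n + 3 by exists (c - n + 3).
move: ft fz; rewrite /phi -DE.
have D0 : D < 0 by rewrite DE; lra.
have Dt : 0 < D + 2 * t by rewrite DE; lra.
set p := (c - 1)^-1; set q := (c - 3)^-1.
have p0 : 0 < p by rewrite invr_gt0; lra.
(* As D < 0, the last term of [phi] is a constant plus a positive multiple of 1 / (D + 2 x), which
   is convex. Then [ab] and [sq] are the chord bounds for this reciprocal and for the square. *)
have E x : t <= x -> x * c / (D + 2 * x) = c / 2 + c / 2 * (- D) * (D + 2 * x)^-1.
  by move=> tx; field; rewrite gt_eqF //; lra.
rewrite !E; [|lra|lra|lra].
set a := (D + 2 * t)^-1; set b := (D + 2 * z)^-1 => ft fz.
have ab : (D + 2 * s)^-1 <= ((z - s) * a + (s - t) * b) / (z - t).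
  rewrite ler_pdivlMr; last lra.
  rewrite mulrC ler_pdivrMr; last lra.
  rewrite /a /b addf_div ?gt_eqF //; [|lra].
  rewrite mulrAC ler_pdivlMr; last by apply: mulr_gt0; lra.
  have : 0 <= (z - t) * ((s - t) * (z - s)) by apply: mulr_ge0; [lra | apply: mulr_ge0; lra].
  nra.
have k0 : 0 < c / 2 * - D by apply: mulr_gt0; lra.
set K := c / 2 * - D in ft fz k0 *.
have {}ab : K * (D + 2 * s)^-1 * (z - t) <= K * ((z - s) * a + (s - t) * b).
  by rewrite -mulrA; apply: ler_wpM2l; [exact: ltW | rewrite -ler_pdivlMr //; lra].
rewrite -(ltr_pM2r (_ : 0 < z - t)); last lra.
have sq : s ^+ 2 * p * (z - t) <= ((z - s) * t ^+ 2 + (s - t) * z ^+ 2) * p.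
  rewrite mulrAC; apply: ler_wpM2r; first exact: ltW.
  have : 0 <= (z - t) * ((s - t) * (z - s)) by apply: mulr_ge0; [lra | apply: mulr_ge0; lra].
  nra.
have fz' : (s - t) * (z ^+ 2 * p + 3 * z * q + (c / 2 + K * b)) < (s - t) * c.
  by rewrite ltr_pM2l //; lra.
have ft' := congr1 (fun x => (z - s) * x) ft; move: ft' => /=.
move: fz' sq ab; clear; nra.
Qed.

End Numerics.

(** * Spectral radius *)

Section Spectral.
Local Open Scope ring_scope.

Definition relsum (R : realType) (T : finType) (e : rel T) (y : T -> R) (v : T) : R :=
  \sum_u (e u v)%:R * y u.

Lemma eigenvalue_adjP (R : realType) (G : sgraph) (a : R) :
  eigenvalue (adjacency_mx R G) a <->
  exists2 z : G -> R, exists v, z v != 0 & forall v, relsum (@adj G) z v = a * z v.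
Proof.
have sumE (w : 'rV[R]_#|G|) j : (w *m adjacency_mx R G) 0 j =
    relsum (@adj G) (fun u => w 0 (enum_rank u)) (enum_val j).
  rewrite mxE /relsum (reindex (@enum_val G (mem G))) /=; last first.
    by apply: onW_bij; exact: enum_val_bij.
  by apply: eq_bigr => i _; rewrite mxE enum_valK mulrC.
split=> [/eigenvalueP[w wE w0]|[z [v zv] zE]].
  exists (fun u => w 0 (enum_rank u)).
    have [j wj] : exists j, w 0 j != 0.
      apply: contrapT => nw; case/negP: w0; apply/eqP/rowP => j; rewrite mxE.
      by apply/eqP; apply: contrapT => /negP wj; apply: nw; exists j.
    by exists (enum_val j); rewrite enum_valK.
  by move=> v; rewrite -[v in LHS]enum_rankK -sumE wE mxE.
apply/eigenvalueP; exists (\row_j z (enum_val j)).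
  apply/rowP => j; rewrite sumE !mxE -zE /relsum; apply: eq_bigr => u _.
  by rewrite mxE enum_rankK.
by apply: contraNneq zv => /rowP/(_ (enum_rank v)); rewrite !mxE enum_rankK => ->.
Qed.

(** * Eigenvalues bounded by a positive vector *)

Section Perron.
Variables (R : realType) (T : finType) (e e' : rel T).
Hypotheses (e's : symmetric e') (ee' : subrel e e').
Variables (y : T -> R) (r : R).
Hypotheses (y_gt0 : forall v, 0 < y v) (ye' : forall v, relsum e' y v <= r * y v).
Variables (z : T -> R) (a : R).
Hypotheses (z0 : exists v, z v != 0) (zE : forall v, relsum e z v = a * z v).

Let w v := `|z v|.

Let w_ge0 v : 0 <= w v.
Proof. exact: normr_ge0. Qed.
Let y_ge0 v : 0 <= y v.
Proof. exact: ltW. Qed.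

Lemma abs_eigenvector v : `|a| * w v <= relsum e w v.
Proof.
rewrite /w -normrM -zE; apply: le_trans (ler_norm_sum _ _ _) _.
by apply: ler_sum => u _; rewrite normrM normr_nat.
Qed.

Lemma perron_pairing : 0 < \sum_v y v * w v.
Proof.
case: z0 => v zv; rewrite (bigD1 v) //= ltr_pwDl //.
  by rewrite mulr_gt0 // normr_gt0.
by apply: sumr_ge0 => u _; rewrite mulr_ge0.
Qed.

(** The pairings of A' y with w and of A w with y are compared through the symmetry of [e']. The
    three sums are the slacks in A' y <= r y, in the inclusion of [e] in [e'] and, for b = |a|, in
    [abs_eigenvector]. *)
Lemma perron_identity b : (r - b) * (\sum_v y v * w v) =
  \sum_u w u * (r * y u - relsum e' y u) +
  \sum_v \sum_u y v * ((e' u v)%:R - (e u v)%:R) * w u +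
  \sum_v y v * (relsum e w v - b * w v).
Proof.
have -> : \sum_u w u * (r * y u - relsum e' y u) =
    r * (\sum_v y v * w v) - \sum_v \sum_u y v * (e' u v)%:R * w u.
  rewrite exchange_big /= mulr_sumr -sumrB; apply: eq_bigr => u _.
  rewrite mulrBr /relsum mulr_sumr; congr (_ - _); first by rewrite mulrCA [w u * _]mulrC.
  by apply: eq_bigr => v _; rewrite e's; ring.
have -> : \sum_v y v * (relsum e w v - b * w v) =
    \sum_v \sum_u y v * (e u v)%:R * w u - b * \sum_v y v * w v.
  rewrite mulr_sumr -sumrB; apply: eq_bigr => v _.
  rewrite mulrBr /relsum mulr_sumr; congr (_ - _); last by ring.
  by apply: eq_bigr => u _; rewrite mulrA.
have -> : \sum_v \sum_u y v * ((e' u v)%:R - (e u v)%:R) * w u =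
    \sum_v \sum_u y v * (e' u v)%:R * w u - \sum_v \sum_u y v * (e u v)%:R * w u.
  rewrite -sumrB; apply: eq_bigr => v _; rewrite -sumrB; apply: eq_bigr => u _.
  by ring.
ring.
Qed.

Lemma perron_ge0_1 u : 0 <= w u * (r * y u - relsum e' y u).
Proof. by rewrite mulr_ge0 // subr_ge0. Qed.

Lemma perron_ge0_2 u v : 0 <= y v * ((e' u v)%:R - (e u v)%:R) * w u.
Proof.
apply: mulr_ge0 => //; apply: mulr_ge0; first exact: ltW.
by have := @ee' u v; case: (e u v) => [->//|_]; rewrite ?subrr // subr0.
Qed.

Lemma perron_ge0_3 v : 0 <= y v * (relsum e w v - `|a| * w v).
Proof. by rewrite mulr_ge0 ?(ltW (y_gt0 v)) // subr_ge0 abs_eigenvector. Qed.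

Lemma eigenvalue_le : a <= r.
Proof.
apply: le_trans (ler_norm a) _; rewrite -subr_ge0 -(pmulr_lge0 _ perron_pairing).
rewrite perron_identity; apply: addr_ge0; last by apply: sumr_ge0 => v _; exact: perron_ge0_3.
apply: addr_ge0; first by apply: sumr_ge0 => v _; exact: perron_ge0_1.
by apply: sumr_ge0 => v _; apply: sumr_ge0 => u _; exact: perron_ge0_2.
Qed.

(** With a = r the left side of [perron_identity] is 0 for b = |a|, so all three slacks vanish. The
    third makes w an eigenvector, positive everywhere by connectedness; the other two then give the
    conclusions. *)
Lemma eigenvalue_eq : a = r -> 0 < r -> (forall u v, connect e u v) ->
  e =2 e' /\ forall v, relsum e' y v = r * y v.
Proof.
move=> ar r0 econn; have na : `|a| = r by rewrite ar ger0_norm // ltW.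
have := perron_identity `|a|; rewrite {1}na subrr mul0r => /esym.
have S1 : 0 <= \sum_u w u * (r * y u - relsum e' y u).
  by apply: sumr_ge0 => v _; exact: perron_ge0_1.
have S2 : 0 <= \sum_v \sum_u y v * ((e' u v)%:R - (e u v)%:R) * w u.
  by apply: sumr_ge0 => v _; apply: sumr_ge0 => u _; exact: perron_ge0_2.
have S3 : 0 <= \sum_v y v * (relsum e w v - `|a| * w v).
  by apply: sumr_ge0 => v _; exact: perron_ge0_3.
move/eqP; rewrite paddr_eq0 ?addr_ge0 // paddr_eq0 // => /andP[/andP[/eqP E1 /eqP E2] /eqP E3].
have wE v : relsum e w v = r * w v.
  have /eqP : y v * (relsum e w v - `|a| * w v) = 0.
    exact: (psumr_eq0P (fun v _ => perron_ge0_3 v) E3).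
  by rewrite mulf_eq0 gt_eqF //= subr_eq0 na => /eqP.
have w_step u v : e u v -> 0 < w u -> 0 < w v.
  move=> euv wu; rewrite -(pmulr_rgt0 _ r0) -wE /relsum (bigD1 u) //= euv mul1r ltr_pwDl //.
  by apply: sumr_ge0 => x _; rewrite mulr_ge0.
have w_gt0 v : 0 < w v.
  case: z0 => v0; rewrite -normr_gt0 => wv0.
  have /connectP[p] := econn v0 v; elim: p v0 wv0 => [|x p IHp] u wu /=; first by move=> _ ->.
  by case/andP=> eux; apply: IHp; apply: w_step wu.
split=> [u v|v].
  have /eqP : y v * ((e' u v)%:R - (e u v)%:R) * w u = 0.
    have E2v : \sum_u y v * ((e' u v)%:R - (e u v)%:R) * w u = 0.
      by apply: (psumr_eq0P _ E2) => // x _; apply: sumr_ge0 => u' _; exact: perron_ge0_2.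
    by apply: (psumr_eq0P _ E2v) => // x _; exact: perron_ge0_2.
  rewrite mulf_eq0 (gt_eqF (w_gt0 u)) orbF mulf_eq0 (gt_eqF (y_gt0 v)) /= subr_eq0 eqr_nat.
  by case: (e u v); case: (e' u v).
have /eqP : w v * (r * y v - relsum e' y v) = 0.
  exact: (psumr_eq0P (fun v _ => perron_ge0_1 v) E1).
by rewrite mulf_eq0 gt_eqF //= subr_eq0 => /eqP.
Qed.

End Perron.

(** A positive eigenvector serves as the test vector in [eigenvalue_le], with both relations equal,
    so no eigenvalue exceeds its own. *)
Lemma spectral_radius_positive (R : realType) (G : sgraph) (y : G -> R) (r : R) (v0 : G) :
  (forall v, 0 < y v) -> (forall v, relsum (@adj G) y v = r * y v) ->
  spectral_radius R G = r.
Proof.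
move=> y0 yE; have ev : eigenvalue (adjacency_mx R G) r.
  by apply/eigenvalue_adjP; exists y => //; exists v0; rewrite gt_eqF.
apply: classical_sets.xget_unique.
  split=> // a /eigenvalue_adjP[z z0 zE].
  apply: (@eigenvalue_le R G (@adj G) (@adj G) (@adj_sym G) _ y r y0 _ z a z0 zE) => //.
  by move=> v; rewrite yE.
move=> b [evb maxb]; apply/eqP; rewrite eq_le (maxb _ ev) andbT.
have /eigenvalue_adjP[z z0 zE] := evb.
apply: (@eigenvalue_le R G (@adj G) (@adj G) (@adj_sym G) _ y r y0 _ z b z0 zE) => //.
by move=> v; rewrite yE.
Qed.

(** Positivity excludes the default value 0 of [xget], so the existence of a largest eigenvalue need
    not be shown for G. *)
Lemma spectral_radius_eigen (R : realType) (G : sgraph) :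
  0 < spectral_radius R G -> eigenvalue (adjacency_mx R G) (spectral_radius R G).
Proof.
rewrite /spectral_radius; case: classical_sets.xgetP => [x -> [] //|_]; by rewrite ltxx.
Qed.

Lemma relsum_complete (R : realType) m (a : R) v :
  relsum (@adj (complete m)) (fun=> a) v = (m%:R - 1) * a.
Proof.
rewrite /relsum -mulr_suml; congr (_ * a).
rewrite (bigD1 v) //= /complete_adj eqxx add0r (eq_bigr (fun=> 1)) => [|u ->//].
rewrite sumr_const cardC1 card_ord -subn1 natrB //.
by case: m v => // -[].
Qed.

Lemma big_gunion (V : Type) (idx : V) (op : Monoid.law idx) (G H : sgraph)
    (F : gunion G H -> V) :
  \big[op/idx]_u F u =
  op (\big[op/idx]_(u : G) F (inl u)) (\big[op/idx]_(u : H) F (inr u)).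
Proof. exact: (big_sumType _ predT F). Qed.

Lemma big_gjoin (V : Type) (idx : V) (op : Monoid.law idx) (G H : sgraph)
    (F : gjoin G H -> V) :
  \big[op/idx]_u F u =
  op (\big[op/idx]_(u : G) F (inl u)) (\big[op/idx]_(u : H) F (inr u)).
Proof. exact: (big_sumType _ predT F). Qed.

(** With weight 1 on K_t, the eigenvector equation on a clique of size k forces the weight t / (c -
    k) there; the equation on K_t is then phi n t c = c. *)
Lemma extremal_spectral_radius (R : realType) (n t : nat) (c : R) :
  (0 < t)%N -> (5 * t + 7 <= n)%N -> n%:R - t%:R - 3 < c -> phi n%:R t%:R c = c ->
  spectral_radius R (extremal_graph n t) = c - 1.
Proof.
move=> t0 tn cn phic; set m := (n - 2 * t - 3)%N.
have tR : 1 <= t%:R :> R by rewrite (ler_nat R 1).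
have nR : 5 * t%:R + 7 <= n%:R :> R by rewrite -natrM -natrD ler_nat.
have mR : m%:R = n%:R - 2 * t%:R - 3 :> R by rewrite /m !natrB ?natrM //; lia.
pose y (v : extremal_graph n t) : R := match v with
  | inl _ => 1
  | inr (inl (inl _)) => t%:R / (c - m%:R)
  | inr (inl (inr _)) => t%:R / (c - 3)
  | inr (inr _) => t%:R / (c - 1) end.
have cm : 0 < c - m%:R by rewrite mR; lra.
have c3 : 0 < c - 3 by lra.
have c1 : 0 < c - 1 by lra.
have v0 : extremal_graph n t by left; exact: Ordinal t0.
apply: (@spectral_radius_positive R _ y _ v0).
  by case=> [v|[[v|v]|v]] /=; rewrite ?ltr01 // divr_gt0 //; lra.
have sumE v : relsum (@adj (extremal_graph n t)) y v =
  \sum_(u : complete t) (@adj (extremal_graph n t) (inl u) v)%:R +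
  (\sum_(u : complete m) (@adj (extremal_graph n t) (inr (inl (inl u))) v)%:R * (t%:R / (c - m%:R)) +
   \sum_(u : complete 3) (@adj (extremal_graph n t) (inr (inl (inr u))) v)%:R * (t%:R / (c - 3)) +
   \sum_(u : gcopies (complete 1) t) (@adj (extremal_graph n t) (inr (inr u)) v)%:R * (t%:R / (c - 1))).
  rewrite /relsum big_gjoin; congr (_ + _).
    by apply: eq_bigr => u _; rewrite mulr1.
  by rewrite !big_gunion.
have all1 (T : finType) (b : R) : \sum_(u : T) true%:R * b = #|T|%:R * b.
  by rewrite -mulr_suml sumr_const.
have all0 (T : finType) (b : R) : \sum_(u : T) false%:R * b = 0.
  by rewrite big1 // => u _; rewrite mul0r.
have all1' (T : finType) : \sum_(u : T) (true%:R : R) = #|T|%:R.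
  by rewrite sumr_const.
have cc k (b : R) (v : complete k) : \sum_(u : complete k) (complete_adj u v)%:R * b =
    (k%:R - 1) * b by exact: (@relsum_complete R k b v).
move: phic; rewrite /phi -[_ - n%:R + _ + _](_ : c - m%:R = _); last by rewrite mR; ring.
move=> phic.
case=> [v|[[v|v]|v]]; rewrite sumE /=.
- have -> : \sum_(u : complete t) (complete_adj u v)%:R = t%:R - 1 :> R.
    by have := cc t 1 v; rewrite -mulr_suml !mulr1.
  rewrite !all1 card_prod !card_ord muln1 mulr1.
  have E : t%:R * c / (c - m%:R) = t%:R + m%:R * (t%:R / (c - m%:R)).
    by field; rewrite gt_eqF.
  by move: phic; rewrite E; lra.
- rewrite all1' !all0 cc card_ord !addr0; field.
  by rewrite gt_eqF.
- rewrite all1' !all0 cc card_ord !addr0 add0r; field.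
  by rewrite gt_eqF.
rewrite all1' !all0 !add0r card_ord big1 ?addr0.
  by field; rewrite gt_eqF.
by move=> [i j] _; rewrite /gcopies_adj /= /complete_adj !ord1 eqxx andbF mul0r.
Qed.

End Spectral.

(** * The weight vector of a saturated graph *)

Section CliqueWeight.
Local Open Scope ring_scope.
Variables (R : realType) (T : finType) (e : rel T) (c : R).
Hypotheses (es : symmetric e) (ei : irreflexive e) (sat : saturated e).
Hypothesis small_cliques : forall C, C \in cliques e -> #|C|%:R < c.
Let S := universal e.

Definition clique_weight v : R :=
  if v \in universal e then 1 else #|universal e|%:R / (c - #|pblock (cliques e) v|%:R).

Lemma pblock_clique v : v \notin S -> pblock (cliques e) v \in cliques e.
Proof.
have /and3P[/eqP covP _ _] := cliques_partition es sat.
by move=> vS; apply: pblock_mem; rewrite covP in_setC.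
Qed.

Lemma clique_notin C v : C \in cliques e -> v \in C -> v \notin S.
Proof.
have /and3P[/eqP covP _ _] := cliques_partition es sat.
by move=> CP vC; rewrite -in_setC -covP; apply/bigcupP; exists C.
Qed.

Lemma mem_clique v : v \notin S -> v \in pblock (cliques e) v.
Proof. by move=> vS; rewrite cliquesP ?eqxx. Qed.

Lemma pblock_eq C v : C \in cliques e -> v \in C -> pblock (cliques e) v = C.
Proof.
have /and3P[_ tP _] := cliques_partition es sat.
by move=> CP vC; apply: def_pblock.
Qed.

Lemma clique_weight_gt0 v : (0 < #|S|)%N -> 0 < clique_weight v.
Proof.
move=> S0; rewrite /clique_weight; case: ifPn => // vS.
by rewrite divr_gt0 ?ltr0n // subr_gt0 small_cliques // pblock_clique.
Qed.

(** The weight y on a clique C solves |S| + (|C| - 1) y = (c - 1) y, so only universal vertices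
    leave an inequality to prove. *)
Lemma relsum_clique v : v \notin S ->
  relsum e clique_weight v = (c - 1) * clique_weight v.
Proof.
move=> vS; set C := pblock (cliques e) v.
have vC : v \in C by exact: mem_clique.
have CP : C \in cliques e by exact: pblock_clique.
rewrite /relsum (bigID (mem S)) /=.
rewrite (eq_bigr (fun=> 1)); last first.
  move=> u uS; rewrite /clique_weight uS mulr1.
  by rewrite (universalP _ _ uS) //; apply: contraNneq vS => ->.
rewrite sumr_const (bigID (mem (C :\ v))) /= [X in _ + (_ + X)]big1 ?addr0; last first.
  move=> u /andP[uS]; rewrite in_setD1 cliquesP //.
  have [->|uv] := eqVneq u v; first by rewrite ei mul0r.
  by rewrite /= es => /negbTE ->; rewrite mul0r.
rewrite (eq_big (mem (C :\ v)) (fun=> clique_weight v)) /=; last 2 first.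
- move=> u; apply: andb_idl; rewrite in_setD1 => /andP[_]; exact: clique_notin.
- move=> u /andP[uS]; rewrite in_setD1 => /andP[uv uC].
  rewrite /clique_weight (negbTE uS) (negbTE vS) -/C (pblock_eq CP uC).
  by move: uC; rewrite cliquesP // eq_sym (negbTE uv) /= es => ->; rewrite mul1r.
rewrite sumr_const -(mulr_natr (clique_weight v)) /clique_weight (negbTE vS) -/C.
have CE : #|C|%:R = 1 + #|C :\ v|%:R :> R by rewrite (cardsD1 v C) vC natrD.
have cC : 0 < c - #|C|%:R by rewrite subr_gt0 small_cliques.
have cC' : c - #|C|%:R != 0 by rewrite gt_eqF.
move: cC'; rewrite CE => cC'.
by field.
Qed.

Lemma relsum_universal v : v \in S -> relsum e clique_weight v =
  #|S|%:R - 1 + #|S|%:R * \sum_(C in cliques e) (#|C|%:R / (c - #|C|%:R)).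
Proof.
move=> vS; rewrite /relsum (bigID (mem S)) /=; congr (_ + _).
  rewrite (bigD1 v) //= ei mul0r add0r (eq_bigr (fun=> 1)); last first.
    move=> u /andP[uS uv]; rewrite /clique_weight uS mulr1 es.
    by rewrite (universalP _ _ vS).
  rewrite (eq_bigl (mem (S :\ v))) => [|u]; last by rewrite /= in_setD1 andbC.
  by rewrite sumr_const (cardsD1 v S) vS natrD addrC addKr.
rewrite (eq_bigr clique_weight); last first.
  move=> u uS; rewrite es (universalP _ _ vS) ?mul1r //.
  by apply: contraNneq uS => ->.
rewrite (eq_bigl (mem (~: S))) => [|u]; last by rewrite /= in_setC.
rewrite (set_partition_big _ (cliques_partition es sat)) mulr_sumr.
apply: eq_bigr => C CP; rewrite (eq_bigr (fun=> #|S|%:R / (c - #|C|%:R))); last first.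
  by move=> u uC; rewrite /clique_weight (negbTE (clique_notin CP uC)) (pblock_eq CP uC).
by rewrite sumr_const -mulr_natl; ring.
Qed.

End CliqueWeight.

(** * The structure of G *)

Lemma tconnected_connect t (G : sgraph) (u v : G) :
  0 < t -> tconnected t G -> connect (@adj G) u v.
Proof.
move=> t0 [_ /(_ set0)]; rewrite cards0 => /(_ t0)[_ conn].
have uE : u \in ~: (set0 : {set G}) by rewrite !inE.
have vE : v \in ~: (set0 : {set G}) by rewrite !inE.
have /connectP[p pth /(congr1 val) /= ->] := conn (Sub u uE) (Sub v vE).
apply/connectP; exists (map val p); last exact: (esym (last_map val p (Sub u uE))).
exact: (homo_path (f := val) (fun x y (xy : induced_adj x y) => xy) pth).
Qed.

(** Every edge of G outside [universal e] stays inside one clique. Deleting fewer than t vertices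
    keeps G connected, which would leave a single clique. *)
Lemma universal_ge t (G : sgraph) (e : rel G) : tconnected t G -> symmetric e -> saturated e ->
  subrel (@adj G) e -> 1 < #|cliques e| -> t <= #|universal e|.
Proof.
move=> [_ conn] es sat sub /card_gt1P[C [D [CP DP CD]]].
rewrite leqNgt; apply/negP=> /conn [_ {}conn].
have /and3P[_ _ nP] := cliques_partition es sat.
have ne B : B \in cliques e -> exists x, x \in B.
  by move=> BP; apply/set0Pn; apply: contraNneq nP => <-.
have [[x xC] [z zD]] := (ne _ CP, ne _ DP).
have xE : x \in ~: universal e by rewrite in_setC (clique_notin es sat CP).
have zE : z \in ~: universal e by rewrite in_setC (clique_notin es sat DP).
have /connectP[p pth lst] := conn (Sub x xE) (Sub z zE).
suff : pblock (cliques e) z = C by rewrite (pblock_eq es sat DP zD) => DC; rewrite DC eqxx in CD.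
have -> : z = val (last (Sub x xE : induced (~: universal e)) p) by rewrite -lst.
have : pblock (cliques e) (val (Sub x xE : induced (~: universal e))) = C.
  exact: (pblock_eq es sat CP).
elim: p (Sub x xE : induced _) pth {lst} => [|w p IHp] u //= /andP[uw pth] uC.
apply: IHp pth _; rewrite -uC; have /and3P[_ tP _] := cliques_partition es sat.
apply: same_pblock => //; have := valP u; have := valP w; rewrite !in_setC => wU uU.
by rewrite cliquesP // (sub _ _ uw) orbT.
Qed.

Lemma double_count_incidence (R : realType) (G : sgraph) (f : {set G} -> R) (A : {set G}) :
  (\sum_(v in A) \sum_(E in edges_at v) f E =
   \sum_(E in edges G) f E *+ #|E :&: A|)%R.
Proof.
rewrite (exchange_big_dep (mem (edges G))) /=; last first.
  by move=> v E _; rewrite inE => /andP[].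
apply: eq_bigr => E EG; rewrite sumr_const; congr (_ *+ _)%R.
by apply: eq_card => v; rewrite !inE unfold_in /= !inE EG andbC.
Qed.

(** A vertex that is a clique by itself has all its G-neighbours in [universal e], so each edge of G
    has at least as many ends in [universal e] as in the set [A] of such vertices. Summing f over
    the edges compares the two cardinalities, as each vertex carries total weight 1. *)
Lemma card_single_cliques (R : realType) (G : sgraph) (e : rel G) (f : {set G} -> R) :
  symmetric e -> saturated e -> subrel (@adj G) e -> fractional_perfect_matching f ->
  #|[set C in cliques e | #|C| == 1]| <= #|universal e|.
Proof.
move=> es sat sub [f01 f1].
pose A := [set v | (v \notin universal e) && (#|pblock (cliques e) v| == 1)].
have Aadj v u : v \in A -> adj v u -> u \in universal e.
  rewrite inE => /andP[vU /cards1P[x xE]] vu; apply: contraT => uU.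
  have : u \in pblock (cliques e) v by rewrite cliquesP // (sub _ _ vu) orbT.
  have : v \in pblock (cliques e) v by rewrite mem_clique.
  by rewrite xE !inE => /eqP vx /eqP ux; rewrite vx ux adj_irr in vu.
apply: (@leq_trans #|A|).
  apply: leq_trans (leq_imset_card set1 (mem A)); apply: subset_leq_card.
  apply/subsetP=> C; rewrite inE => /andP[CP C1]; have /cards1P[v Cv] := C1.
  have vC : v \in C by rewrite Cv inE.
  apply/imsetP; exists v => //.
  by rewrite inE (clique_notin es sat CP vC) (pblock_eq es sat CP vC) C1.
rewrite -(ler_nat R).
have sum1 (B : {set G}) : (#|B|%:R = \sum_(v in B) \sum_(E in edges_at v) f E)%R.
  by rewrite (eq_bigr (fun=> 1%R)) ?sumr_const.
rewrite !sum1 !double_count_incidence; apply: ler_sum => E EG.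
apply: ler_wpMn2l; first by have /andP[] := f01 _ EG.
have [[u v] uv EE] := imsetP EG; rewrite inE /= in uv; rewrite {E EG}EE /=.
have [->|nz] := eqVneq ([set u; v] :&: A) set0; first by rewrite cards0.
wlog uA : u v uv nz / u \in A.
  move=> W; have [x] := set0Pn _ nz; rewrite in_setI in_set2 => /andP[/orP[] /eqP -> xA].
    exact: W.
  by rewrite setUC; apply: W; rewrite 1?adj_sym // setUC.
have vU := Aadj _ _ uA uv.
apply: (@leq_trans 1).
  rewrite (_ : _ :&: A = [set u]) ?cards1 //; apply/setP=> x; rewrite in_setI in_set2 in_set1.
  have [->|xu] //= := eqVneq x u.
  have [->|//] := eqVneq x v; apply/negbTE; rewrite [v \in A]inE vU //.
by apply/card_gt0P; exists v; rewrite !in_setI in_set2 eqxx orbT vU.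
Qed.

Lemma perfect_matching_kmatching k (G : sgraph) : has_perfect_matching (@adj G) ->
  exists f : {set G} -> nat, perfect_kmatching k f.
Proof.
move=> [m [mK me] Em].
have mx x : m x != x by apply/negP=> mx; have := in_set0 x; rewrite -Em inE mx.
exists (fun E => if [exists v, E == [set v; m v]] then k else 0).
have sumE v : \sum_(E in edges_at v) (if [exists x, E == [set x; m x]] then k else 0) = k.
  have vE : [set v; m v] \in edges_at v.
    rewrite !inE eqxx /= andbT; apply/imsetP; exists (v, m v) => //.
    by rewrite inE me.
  rewrite (bigD1 [set v; m v]) //= big1 ?addn0; last first.
    move=> E /andP[]; rewrite inE => /andP[_ vE'] nE; case: ifP => // /existsP[x /eqP Ex].
    move: vE' nE; rewrite Ex !inE => /orP[] /eqP ->; first by rewrite eqxx.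
    by rewrite mK setUC eqxx.
  by rewrite ifT //; apply/existsP; exists v.
split=> //; split=> [E _|v]; last by rewrite sumE.
by case: ifP.
Qed.

(** The fibres over each label are enumerated on both sides and matched by position; since their
    sizes agree, the default [y0] is never reached. *)
Lemma label_bijection (T U : finType) (L : eqType) (p : T -> L) (q : U -> L) (y0 : U) :
  (forall l, #|[set x | p x == l]| = #|[set y | q y == l]|) -> #|U| <= #|T| ->
  exists2 f : T -> U, bijective f & forall x, q (f x) = p x.
Proof.
move=> pq cardTU; pose A l := enum [set x | p x == l]; pose B l := enum [set y | q y == l].
have sizeAB l : size (A l) = size (B l) by rewrite -!cardE.
pose f x := nth y0 (B (p x)) (index x (A (p x))).
have ltB x : index x (A (p x)) < size (B (p x)).
  by rewrite -sizeAB index_mem mem_enum inE.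
have qf x : q (f x) = p x.
  by have := mem_nth y0 (ltB x); rewrite mem_enum inE => /eqP.
exists f => //; apply: inj_card_bij => // x x' fxx'.
have pxx' : p x = p x' by rewrite -!qf fxx'.
have xA : x \in A (p x') by rewrite mem_enum inE pxx'.
have x'A : x' \in A (p x') by rewrite mem_enum inE.
move: fxx' (ltB x) (ltB x'); rewrite /f pxx' => /eqP fxx' lx lx'.
by move: fxx'; rewrite nth_uniq ?enum_uniq // => /eqP; apply: index_inj.
Qed.

(* Labels: (true, true) for K_t, (true, false) for K_(n-2t-3), (false, true) for K_3
   and (false, false) for t K_1. *)
Definition extremal_label n t (v : extremal_graph n t) : bool * bool :=
  match v with
  | inl _ => (true, true)
  | inr (inl (inl _)) => (true, false)
  | inr (inl (inr _)) => (false, true)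
  | inr (inr _) => (false, false)
  end.

Definition label_adj (l l' : bool * bool) : bool :=
  [|| l == (true, true), l' == (true, true) | (l == l') && (l != (false, false))].

Lemma extremal_adjE n t (u v : extremal_graph n t) :
  adj u v = (u != v) && label_adj (extremal_label u) (extremal_label v).
Proof.
case: u v => [u|[[u|u]|[u i]]] [v|[[v|v]|[v j]]];
  rewrite /label_adj /= ?andbT ?andbF //.
by rewrite /gcopies_adj /= /complete_adj [i]ord1 [j]ord1 eqxx andbF.
Qed.

Lemma card_extremal_label n t l : #|[set v | @extremal_label n t v == l]| =
  match l with
  | (true, true) | (false, false) => t
  | (true, false) => n - 2 * t - 3
  | (false, true) => 3
  end.
Proof.
rewrite -sum1dep_card big_mkcond big_gjoin !big_gunion /=.
by case: l => [[] []] /=; rewrite !sum_nat_const ?card_prod ?card_ord; lia.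
Qed.

Lemma card_extremal n t : 2 * t + 3 <= n -> #|extremal_graph n t| = n.
Proof.
move=> tn; rewrite -sum1_card big_gjoin !big_gunion /= !sum_nat_const ?card_prod ?card_ord.
lia.
Qed.

(** In both graphs, adjacency of distinct vertices depends only on their labels, so a
    label-preserving bijection is an isomorphism. *)
Lemma saturated_extremal n t (G : sgraph) (e : rel G) (C D : {set G}) :
  symmetric e -> irreflexive e -> saturated e -> @adj G =2 e -> #|G| = n -> 2 * t + 6 < n ->
  #|universal e| = t -> C \in cliques e -> D \in cliques e ->
  #|C| = n - 2 * t - 3 -> #|D| = 3 ->
  (forall B, B \in cliques e -> B != C -> B != D -> #|B| = 1) ->
  giso G (extremal_graph n t).
Proof.
move=> es ei sat adjE Gn tn St CP DP cC cD rest.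
pose p v := if v \in universal e then (true, true) else
  if v \in C then (true, false) else if v \in D then (false, true) else (false, false).
have CD : C != D by apply/eqP=> CD; move: cC; rewrite CD cD; lia.
have disj v : v \in C -> v \in D -> False.
  move=> vC vD; case/eqP: CD.
  by rewrite -(pblock_eq es sat CP vC) (pblock_eq es sat DP vD).
have CU := clique_notin es sat CP; have DU := clique_notin es sat DP.
have eE u v : e u v = (u != v) && label_adj (p u) (p v).
  have [->|uv] /= := eqVneq u v; first exact: ei.
  have vu : v != u by rewrite eq_sym.
  rewrite /p; case: (boolP (u \in universal e)) => [uU|uU].
    by rewrite (universalP _ _ uU).
  case: (boolP (v \in universal e)) => [vU|vU].
    by rewrite es (universalP _ _ vU) // /label_adj eqxx orbT.
  have -> : e u v = (v \in pblock (cliques e) u) by rewrite cliquesP // (negbTE uv).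
  have [uC|uC] := boolP (u \in C).
    by rewrite (pblock_eq es sat CP uC); case: (v \in C); case: (v \in D).
  have [uD|uD] := boolP (u \in D).
    rewrite (pblock_eq es sat DP uD); have := @disj v.
    by case: (v \in C); case: (v \in D) => // H; case: H.
  have uB := mem_clique es sat uU.
  have /eqP/cards1P[x xB] : #|pblock (cliques e) u| = 1.
    apply: rest; first exact: pblock_clique.
      by apply: contraNneq uC => <-.
    by apply: contraNneq uD => <-.
  move: uB; rewrite xB !inE => /eqP <-; rewrite (negbTE vu).
  by case: (v \in C); case: (v \in D).
have cardp l : #|[set v | p v == l]| = #|[set v | @extremal_label n t v == l]|.
  have cTT : #|[set v | p v == (true, true)]| = t.
    rewrite -St; apply: eq_card => v; rewrite [in LHS]inE /p.
    by case: (v \in universal e); case: (v \in C); case: (v \in D).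
  have cTF : #|[set v | p v == (true, false)]| = n - 2 * t - 3.
    rewrite -cC; apply: eq_card => v; rewrite inE /p; have := CU v.
    by case: (v \in universal e); case: (v \in C); case: (v \in D) => // /(_ isT).
  have cFT : #|[set v | p v == (false, true)]| = 3.
    rewrite -cD; apply: eq_card => v; rewrite inE /p; have := DU v; have := @disj v.
    case: (v \in universal e); case: (v \in C); case: (v \in D) => // H1 H2.
    - by have := H2 isT.
    - by have := H2 isT.
    - by have := H1 isT isT.
  (* The vertices in singleton cliques are counted by subtraction from n. *)
  have tot : #|[set v | p v == (true, true)]| + #|[set v | p v == (true, false)]| +
     #|[set v | p v == (false, true)]| + #|[set v | p v == (false, false)]| = n.
    rewrite -!sum1dep_card -Gn -sum1_card; apply/esym.
    rewrite (bigID (fun v => p v == (true, true))) /= -!addnA; congr (_ + _).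
    rewrite (bigID (fun v => p v == (true, false))) /=; congr (_ + _).
      by apply: eq_bigl => v; case: (p v) => [[] []].
    rewrite (bigID (fun v => p v == (false, true))) /=; congr (_ + _).
      by apply: eq_bigl => v; case: (p v) => [[] []].
    by apply: eq_bigl => v; case: (p v) => [[] []].
  rewrite card_extremal_label; case: l => [[] []] //.
  move: tot; rewrite cTT cTF cFT => tot.
  by apply: (@addnI (t + (n - 2 * t - 3) + 3)); rewrite tot; lia.
have t0 : 0 < #|extremal_graph n t| by rewrite card_extremal; lia.
have [y0 _] := card_gt0P t0.
have [|f bf qf] := label_bijection y0 cardp; first by rewrite card_extremal ?Gn; lia.
exists f; split=> // u v; rewrite extremal_adjE !qf adjE eE.
by rewrite (inj_eq (bij_inj bf)).
Qed.

(** The left side is s + s * sum_C g(|C|) for the cliques K_N, K_3 and s K_1; its terms s and s N /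
    (c - N) merge into s c / (c - N). *)
Lemma phi_clique_sum (R : realType) (n s N : nat) (c : R) :
  n = (N + 2 * s + 3)%N -> (N%:R < c)%R -> (3 < c)%R ->
  (s%:R + s%:R * (s%:R * (1%:R / (c - 1%:R)) + 3%:R / (c - 3%:R) + N%:R / (c - N%:R)) =
   phi n%:R s%:R c)%R.
Proof.
move=> nE cN c3; rewrite /phi.
have -> : (c - n%:R + 3 + 2 * s%:R = c - N%:R)%R by rewrite nE 2!natrD natrM; ring.
field; rewrite !gt_eqF //; lra.
Qed.

Lemma perfect_matching_of_spectral_radius (R : realType) (t n : nat) (G : sgraph) :
  0 < t -> tconnected t G -> #|G| = n -> ~~ odd n -> 5 * t + 7 <= n ->
  (exists f : {set G} -> R, fractional_perfect_matching f) ->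
  (spectral_radius R (extremal_graph n t) <= spectral_radius R G)%R ->
  ~ giso G (extremal_graph n t) -> has_perfect_matching (@adj G).
Proof.
move=> t0 conn Gn evn tn [f frac] rho niso; apply: contrapT => npm.
have [e [es ei sub sat]] := saturated_ext (@adj_sym G) (@adj_irr G) npm.
set P := cliques e; set s := #|universal e|.
have /and3P[/eqP covP tP nP] := cliques_partition es sat.
have evG : ~~ odd #|G| by rewrite Gn.
have many : s + 2 <= #|[set C in P | odd #|C|]| by exact: leq_card_odd_cliques.
have few : #|[set C in P | #|C| == 1]| <= s by exact: (card_single_cliques es sat sub frac).
have pos C : C \in P -> 0 < #|C|.
  by move=> CP; rewrite card_gt0; apply: contraNneq nP => <-.
have sumP : \sum_(C in P) #|C| = n - s.
  by rewrite -(card_partition (cliques_partition es sat)) cardsCs setCK Gn.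
have szP C : C \in P -> #|C| + s + 3 <= n - s.
  by move=> CP; rewrite -sumP; apply: (clique_size_le pos many few).
have [C0 C0P C03] := exists_big_odd many few.
have := szP _ C0P; set N := n - 2 * s - 3 => szC0.
have nE : n = N + 2 * s + 3 by rewrite /N; lia.
have sumN : \sum_(C in P) #|C| = N + s + 3 by rewrite sumP /N; lia.
have cardP : 1 < #|P|.
  have : #|[set C in P | odd #|C|]| <= #|P|.
    by apply: subset_leq_card; apply/subsetP=> C; rewrite inE => /andP[].
  lia.
have ts : t <= s by exact: (universal_ge conn es sat sub cardP).
have N3 : 3 <= N by rewrite /N; lia.
have leN C : C \in P -> #|C| <= N by move=> /szP; rewrite /N; lia.
have s0 : 0 < s by lia.
have tn6 : 2 * t + 6 < n by lia.
have tR : (1 <= t%:R :> R)%R by rewrite (ler_nat R 1).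
have nR : (5 * t%:R + 7 <= n%:R :> R)%R by rewrite -natrM -natrD ler_nat.
have [c [c1 c2 c0 phic]] := phi_root tR nR.
have sR : (t%:R <= s%:R :> R)%R by rewrite ler_nat.
have nER : (n%:R = N%:R + 2 * s%:R + 3 :> R)%R by rewrite nE 2!natrD natrM.
have c3 : (3 < c)%R by lra.
have cN : (N%:R < c)%R by lra.
(* Here N >= 3 amounts to s <= (n - 6) / 2, the right end of the convexity interval. *)
have phis : t < s -> (phi n%:R s%:R c < c)%R.
  move=> lts; apply: (phi_lt c1 c2 c3 _ phic); first lra.
  - exact: (phi_endpoint tR nR c1 c0).
  - by rewrite ltr_nat.
  - have : (3 <= N%:R :> R)%R by rewrite (ler_nat R 3).
    lra.
have small C : C \in P -> (#|C|%:R < c)%R.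
  by move=> /leN CN; apply: le_lt_trans cN; rewrite ler_nat.
have [sumle sumeq] := clique_sum_le pos many few sumN c3 cN.
have y0 v : (0 < clique_weight e c v)%R by exact: clique_weight_gt0.
have s0R : (0 < s%:R :> R)%R by rewrite ltr0n.
have := phi_clique_sum nE cN c3; set K := (_ + N%:R / _)%R => phisE.
have phile : (phi n%:R s%:R c <= c)%R.
  by case: (ltngtP t s) ts => // [/phis/ltW //|<- _]; rewrite phic.
have sumK : (s%:R * \sum_(C in P) (#|C|%:R / (c - #|C|%:R)) <= s%:R * K)%R.
  by rewrite ler_pM2l.
have ye v : (relsum e (clique_weight e c) v <= (c - 1) * clique_weight e c v)%R.
  have [vU|vU] := boolP (v \in universal e); last by rewrite relsum_clique.
  rewrite relsum_universal // /clique_weight vU -/s -/P; lra.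
have rhoE : spectral_radius R (extremal_graph n t) = (c - 1)%R.
  exact: extremal_spectral_radius.
rewrite rhoE in rho.
have c10 : (0 < c - 1)%R by lra.
have /eigenvalue_adjP[z z0 zE] := spectral_radius_eigen (lt_le_trans c10 rho).
have rhole := eigenvalue_le es sub y0 ye z0 zE.
have rhoeq : spectral_radius R G = (c - 1)%R by apply/eqP; rewrite eq_le rhole rho.
have [adjE yE] := eigenvalue_eq es sub y0 ye z0 zE rhoeq c10
  (fun u v => tconnected_connect u v t0 conn).
have [v vU] : exists v, v \in universal e by apply/card_gt0P.
(* Equality at a universal vertex says that s + s * sum_C g(|C|) = c. The left side is at most phi n
   s c, which is less than c when s > t. *)
have := yE v; rewrite relsum_universal // /clique_weight vU -/s -/P => yv.
have st : s = t.
  by apply/eqP; rewrite eqn_leq ts andbT leqNgt; apply/negP=> /phis; lra.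
(* With s = t the bound on the clique sum is attained as well, which determines the clique sizes. *)
have [|a [b [[aP bP aN b3] rest]]] := sumeq.
  rewrite -/K; apply: (mulfI (lt0r_neq0 s0R)).
  have : phi n%:R s%:R c = c by rewrite st.
  lra.
apply: niso; apply: (@saturated_extremal n t G e a b) => //.
by rewrite -st.
Qed.

Theorem theorem1p4 (R : realType) (t k n : nat) (G : sgraph) :
  0 < t -> 0 < k -> k = 1 %[mod 2] ->
  tconnected t G ->
  #|G| = n -> ~~ odd n -> 5 * t + 7 <= n ->
  (exists f : {set G} -> R, fractional_perfect_matching f) ->
  (spectral_radius R (extremal_graph n t) <= spectral_radius R G)%R ->
  ~ giso G (extremal_graph n t) ->
  exists f : {set G} -> nat, perfect_kmatching k f.
Proof.
move=> t0 _ _ conn Gn evn tn frac rho niso; apply: perfect_matching_kmatching.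
exact: (perfect_matching_of_spectral_radius t0 conn Gn evn tn frac rho niso).
Qed.
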